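(* Assume that $1<q\le p\le\infty$, $0<\gamma<\frac{d}{q}$ and $-\frac{d}{q}\le\beta<-\gamma$. Let $\phi\in\mathcal{G}_{q,p}$ be such that there is a constant $C>0$ with $$\int_{r}^{\infty}\phi^{q}(t)\,t^{\frac{dq}{p}-1}\,dt\le C\,\phi^{q}(r)\,r^{\frac{dq}{p}}\quad\text{for every } r>0,$$ and such that there is a constant $C'>0$ with $\phi(r)\le C' r^{\beta}$ for every $r>0$. Put $$\frac{1}{\bar p}=\frac1p\left(1+\frac{\gamma}{\beta}\right)\quad\text{and}\quad \frac{1}{\bar q}=\frac1q\left(1+\frac{\gamma}{\beta}\right),$$ and $\psi(r)=(\phi(r))^{\frac{q}{\bar q}}$ for $r>0$. Then there is a constant $K>0$ such that for all $f\in(L^{q},L^{p})^{\phi}(\mathbb{R}^{d})$, $$\|I_{\gamma}f\|_{(L^{\bar q},L^{\bar p})^{\psi}(\mathbb{R}^{d})}\le K\,\|f\|_{(L^{q},L^{p})^{\phi}(\mathbb{R}^{d})}.$$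
   Context: Convention: $\frac1\infty=0$. $L^{0}(\mathbb{R}^{d})$ is the space of (a.e. equivalence classes of) Lebesgue measurable complex-valued functions on $\mathbb{R}^d$; $B(y,r)$ is the open ball with center $y\in\mathbb{R}^d$ and radius $r>0$. For $1\le q\le p\le\infty$, $\mathcal{G}_{q,p}$ is the set of all functions $\phi:(0,\infty)\to(0,\infty)$ such that $t\mapsto\phi(t)t^{d/p}$ is almost decreasing (there is $C>0$ with $\phi(s)s^{d/p}\le C\phi(r)r^{d/p}$ whenever $0<r\le s<\infty$) and $t\mapsto\phi(t)t^{d/q}$ is almost increasing (there is $C>0$ with $\phi(r)r^{d/q}\le C\phi(s)s^{d/q}$ whenever $0<r\le s<\infty$). For $r>0$ and $f\in L^0(\mathbb{R}^d)$, put ${}_{r}\|f\|_{q,p}=\left\|\left[\int_{\mathbb{R}^d}|f\chi_{B(y,r)}|^{q}(x)\,dx\right]^{1/q}\right\|_{p}$, the $L^{p}(\mathbb{R}^d)$-norm being taken in the variable $y$ (usual modification if $q=\infty$). For $\phi\in\mathcal{G}_{q,p}$ the generalized Fofana space $(L^{q},L^{p})^{\phi}(\mathbb{R}^{d})$ is the set of all $f\in L^{0}(\mathbb{R}^{d})$ with $$\|f\|_{(L^{q},L^{p})^{\phi}(\mathbb{R}^{d})}=\sup_{r>0}\frac{1}{\phi(r)}\,r^{d(-\frac1q-\frac1p)}\;{}_{r}\|f\|_{q,p}<\infty.$$ For $0<\gamma<d$, the Riesz potential (fractional integral operator) is $I_{\gamma}f(x)=\int_{\mathbb{R}^{d}}\frac{f(y)}{|x-y|^{d-\gamma}}\,dy$,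 $x\in\mathbb{R}^d$. *)

(* Defs.v *)
From HB Require Import structures.
From mathcomp Require Import all_boot all_order all_algebra.
From mathcomp Require Import all_classical all_reals all_analysis.
From mathcomp.real_closed Require Import complex.

Set Implicit Arguments.
Unset Strict Implicit.
Unset Printing Implicit Defensive.
Import Order.TTheory GRing.Theory Num.Theory.
Import numFieldNormedType.Exports.
Import Normc.

Local Open Scope classical_set_scope.
Local Open Scope ring_scope.

Section borel_measure.
Context {R : realType}.
Local Notation mR := (measurableTypeR R).

Definition tcons (d : nat) (u : mR * d.-tuple mR) : d.+1.-tuple mR :=
  [tuple of u.1 :: u.2].

Lemma measurable_tcons d : measurable_fun setT (@tcons d).
Proof. exact: measurable_cons. Qed.

Section borel_step.
Variables (d : nat) (mu : {sigma_finite_measure set (d.-tuple mR) -> \bar R}).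

Definition borel_step : set (d.+1.-tuple mR) -> \bar R :=
  pushforward (@lebesgue_measure R \x mu)%E (@tcons d).

Let borel_step0 : borel_step set0 = 0%E.
Proof. by rewrite /borel_step /pushforward preimage_set0 measure0. Qed.

Let borel_step_ge0 A : (0 <= borel_step A)%E.
Proof. by rewrite /borel_step /pushforward measure_ge0. Qed.

Let borel_step_sigma_additive : semi_sigma_additive borel_step.
Proof.
have mt := @measurable_tcons d.
move=> F mF tF mUF; rewrite /borel_step /pushforward preimage_bigcup.
apply: measure_semi_sigma_additive.
- by move=> n; rewrite -[X in measurable X]setTI; exact: mt.
- apply/trivIsetP => /= i j _ _ ij; rewrite -preimage_setI.
  by move/trivIsetP : tF => /(_ _ _ _ _ ij) ->//; rewrite preimage_set0.
- by rewrite -preimage_bigcup -[X in measurable X]setTI; exact: mt.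
Qed.

HB.instance Definition _ := isMeasure.Build _ _ _ borel_step
  borel_step0 borel_step_ge0 borel_step_sigma_additive.

Let borel_step_sigma_finite : sigma_finite setT borel_step.
Proof.
have /sigma_finiteP[G [TG ndG Goo]] := sigma_finiteT mu.
have /sigma_finiteP[F [TF ndF Foo]] := @sigma_finiteT _ _ _
  (@lebesgue_measure R : {sigma_finite_measure set mR -> \bar R}).
pose g (t : d.+1.-tuple mR) : mR * d.-tuple mR := (thead t, [tuple of behead t]).
have Kg u : g (tcons u) = u.
  by case: u => x t; rewrite /tcons /g/= theadE; congr pair; exact: val_inj.
have mg : measurable_fun setT g.
  apply: measurable_fun_pair; last exact: measurable_behead.
  exact: (measurable_tnth ord0).
exists (fun n => g @^-1` (F n `*` G n)).
  rewrite -preimage_bigcup; apply/esym/seteqP; split => // t _ /=.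
  have [i _ Fi] : (\bigcup_i F i) (g t).1 by rewrite -TF.
  have [j _ Gj] : (\bigcup_i G i) (g t).2 by rewrite -TG.
  exists (maxn i j) => //; split.
  - by move: Fi; exact/subsetPset/ndF/leq_maxl.
  - by move: Gj; exact/subsetPset/ndG/leq_maxr.
move=> n; have [mF Fn] := Foo n; have [mG Gn] := Goo n.
have mFG : measurable (F n `*` G n) by exact: measurableX.
split; first by rewrite -[X in measurable X]setTI; exact: mg.
rewrite /borel_step /pushforward -comp_preimage (_ : g \o _ = id)//; last first.
  by apply/funext => u; exact: Kg.
by rewrite preimage_id product_measure1E// lte_mul_pinfty// ge0_fin_numE.
Qed.

HB.instance Definition _ :=
  Measure_isSigmaFinite.Build _ _ _ borel_step borel_step_sigma_finite.

End borel_step.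

Fixpoint borel_lebesgue (d : nat) :
    {sigma_finite_measure set (d.-tuple mR) -> \bar R} :=
  match d with
  | 0 => \d_([tuple] : 0.-tuple mR)
  | d'.+1 => borel_step (borel_lebesgue d')
  end.
End borel_measure.

(* The points of R^d are d-tuples of reals. The sigma-algebra is the one of the
   Lebesgue (not only Borel) measurable sets: by Caratheodory's construction
   from the product measure, leb is the completion of borel_lebesgue. *)
Definition Rd (R : realType) (d : nat) : measurableType _ :=
  caratheodory_type ((@borel_lebesgue R d)^*)%mu.

Definition leb (R : realType) (d : nat) : set (Rd R d) -> \bar R :=
  @completed_measure_extension _ _ R (@borel_lebesgue R d).

HB.instance Definition _ (R : realType) (d : nat) := Measure.on (@leb R d).

Section fofana.
Context {R : realType} {d : nat}.
Implicit Types (x y : Rd R d) (f : Rd R d -> R[i]) (p q : \bar R).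

(* The norm that MathComp-Analysis puts on row vectors is the sup norm. *)
Definition edist x y : R :=
  Num.sqrt (\sum_(i < d) (tnth x i - tnth y i) ^+ 2).

Definition eball y (r : R) : set (Rd R d) := [set x | edist x y < r].

Definition in_L0 f : Prop :=
  measurable_fun setT (fun x => complex.Re (f x)) /\
  measurable_fun setT (fun x => complex.Im (f x)).

(* 1/p as a real number, with 1/+oo = 0. *)
Definition rinv p : R := fine (p^-1)%E.

(* Only the values of phi on ]0, +oo[ are relevant. *)
Definition class_G q p (phi : R -> R) : Prop :=
  [/\ forall t, 0 < t -> 0 < phi t,
      exists2 C : R, 0 < C & forall r s, 0 < r -> r <= s ->
        phi s * s `^ (d%:R * rinv p) <= C * (phi r * r `^ (d%:R * rinv p))
    & exists2 C : R, 0 < C & forall r s, 0 < r -> r <= s ->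
        phi r * r `^ (d%:R * rinv q) <= C * (phi s * s `^ (d%:R * rinv q))].

Definition amalgam_norm (r : R) q p f : \bar R :=
  Lnorm (@leb R d) p (fun y =>
    Lnorm (@leb R d) q (fun x => (normc (f x) * \1_(eball y r) x)%:E)).

Definition fofana_norm q p (phi : R -> R) f : \bar R :=
  ereal_sup [set
    (((phi r)^-1 * r `^ (d%:R * (- rinv q - rinv p)))%:E * amalgam_norm r q p f)%E
  | r in `]0, +oo[].

Definition fofana q p (phi : R -> R) : set (Rd R d -> R[i]) :=
  [set f | in_L0 f /\ (fofana_norm q p phi f < +oo)%E].

Definition riesz_kernel (gamma : R) x y : R := (edist x y `^ (d%:R - gamma))^-1.

(* Absolute convergence of the integral defining the Riesz potential at x. *)
Definition riesz_cvg (gamma : R) f x : Prop :=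
  (@leb R d).-integrable setT
    (fun y => (complex.Re (f y) * riesz_kernel gamma x y)%:E) /\
  (@leb R d).-integrable setT
    (fun y => (complex.Im (f y) * riesz_kernel gamma x y)%:E).

Definition riesz (gamma : R) f x : R[i] :=
  Complex (\int[@leb R d]_y (complex.Re (f y) * riesz_kernel gamma x y))
          (\int[@leb R d]_y (complex.Im (f y) * riesz_kernel gamma x y)).

End fofana.

(* Main.v *)
(* No maximal function is needed.  Write m(x,t) for the integral of |f| over
   B(x,t), and let N be the norm of f; f may be normalised to N = 1.  The growth
   bound phi(r) <= C' r^beta gives m(x,t) <= C t^(d+beta), so the part of the
   potential coming from |x-y| >= rho is at most C rho^(gamma+beta).

   Near a ball B(y,r), split f = g + h with g = f on B(y,2r).
   - The potential of h on B(y,r) is comparable to its value at y, where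
     Hedberg's argument bounds it by C M^(1+gamma/beta) with M the largest
     average of |f| over the balls B(y,t), t >= r.
   - The potential of g satisfies a strong-type (q, qbar) bound.  At height l,
     take rho with C rho^(gamma+beta) = l and s with C s rho^gamma = l; what
     remains above 2l comes from g 1_(g > s) near x and is estimated in L^1 by
     Tonelli.  Summing over dyadic l gives a geometric series dominated by g^q.
   Together these bound the qbar-mass of the potential on B(y,r) by
   C r^d sup_k (2^k r)^(-d) U(y, 2^k r), where U(y,t) is the q-mass of f on
   B(y,t).  For p finite, the sup is replaced by an l^(p/q) sum in k and
   integrated in y; the integral condition on phi, read on dyadic intervals,
   sums the result.  For p infinite phi is almost decreasing, which suffices. *)
Require Import Defs.
From HB Require Import structures.
From mathcomp Require Import all_boot all_order all_algebra.
From mathcomp Require Import all_classical all_reals all_analysis.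
From mathcomp.real_closed Require Import complex.
From mathcomp Require Import ess_sup_inf measurable_realfun zify ring lra.

Set Implicit Arguments.
Unset Strict Implicit.
Unset Printing Implicit Defensive.
Import Order.TTheory GRing.Theory Num.Theory.
Import numFieldNormedType.Exports.

Local Open Scope classical_set_scope.
Local Open Scope ring_scope.

(** * Lebesgue measure of Euclidean balls *)

(** The estimates are not linear in the growth constant: it fixes the radius that separates the near
    from the far part, and the strong-type constant depends on it. Dividing by a bound [M] of the
    norm first makes the growth constant depend only on [C'], the exponents and the geometry; [M]
    returns by homogeneity at the end. The growth bound is needed around every point, whereas the
    norm controls ball masses only on average over the centre (or almost everywhere). Comparing the
    ball of radius r at y with that of radius 2r at each z within r of y bridges the gap. For p
    finite, the radius at which the supremum over k is nearly attained varies with y, so the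
    supremum cannot be integrated directly. A sum of powers p/q can be integrated term by term, each
    term involving the norm of f at a single radius. The argument sees the space only through its
    distance and the volume of balls up to constants; hence it is carried out on Ahlfors-regular
    spaces, with Euclidean space as an instance. *)

HB.instance Definition _ (R : realType) (d : nat) :=
  Measure_isSigmaFinite.Build _ _ _ (@leb R d)
    (completed_measure_extension_sigma_finite
      (sigma_finiteT (@borel_lebesgue R d))).

Section euclidean.
Context {R : realType} {d : nat}.
Local Notation mR := (measurableTypeR R).
Local Notation edist := (@Defs.edist R d).
Implicit Types x y z : Rd R d.

Lemma measurable_borel_Rd (A : set (d.-tuple mR)) :
  measurable A -> measurable (A : set (Rd R d)).
Proof. exact: caratheodory_measurable_mu_ext. Qed.

Lemma leb_borel (A : set (d.-tuple mR)) :
  measurable A -> leb (A : set (Rd R d)) = borel_lebesgue d A.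
Proof. exact: measurable_mu_extE. Qed.

Lemma measurable_coord (i : 'I_d) :
  measurable_fun setT (fun x : Rd R d => tnth x i : R).
Proof.
move=> _ Y mY; apply: measurable_borel_Rd.
exact: (measurable_tnth i).
Qed.

Lemma edistE x y : edist x y = (\sum_(i < d) (tnth x i - tnth y i) ^+ 2) `^ 2^-1.
Proof. by rewrite powR12_sqrt// sumr_ge0// => i _; exact: sqr_ge0. Qed.

Lemma measurable_edist :
  measurable_fun setT (fun u : Rd R d * Rd R d => edist u.1 u.2).
Proof.
under eq_fun do rewrite edistE.
apply: (measurableT_comp (measurable_powR _)).
apply: measurable_sum => i; apply: measurable_funX.
apply: measurable_funB.
- exact: (measurableT_comp (measurable_coord i) measurable_fst).
- exact: (measurableT_comp (measurable_coord i) measurable_snd).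
Qed.

Lemma edist_ge0 x y : 0 <= edist x y.
Proof. exact: sqrtr_ge0. Qed.

Lemma edistC x y : edist x y = edist y x.
Proof.
by rewrite /Defs.edist; congr Num.sqrt; apply: eq_bigr => i _; rewrite -sqrrN opprB.
Qed.

Lemma edist_triangle x y z : edist x z <= edist x y + edist y z.
Proof.
rewrite /Defs.edist.
pose a i := tnth x i - tnth y i : R; pose b i := tnth y i - tnth z i : R.
have abE i : tnth x i - tnth z i = a i + b i :> R by rewrite /a /b; ring.
under eq_bigr do rewrite abE.
rewrite -[X in _ <= Num.sqrt X + _]/(\sum_(i < d) a i ^+ 2).
rewrite -[X in _ <= _ + Num.sqrt X]/(\sum_(i < d) b i ^+ 2).
set A := \sum_(i < d) a i ^+ 2; set B := \sum_(i < d) b i ^+ 2.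
have A0 : 0 <= A by apply: sumr_ge0 => i _; exact: sqr_ge0.
have B0 : 0 <= B by apply: sumr_ge0 => i _; exact: sqr_ge0.
pose X := Num.sqrt A; pose Y := Num.sqrt B.
have X0 : 0 <= X by exact: sqrtr_ge0.
have Y0 : 0 <= Y by exact: sqrtr_ge0.
have XA : X ^+ 2 = A by exact: sqr_sqrtr.
have YB : Y ^+ 2 = B by exact: sqr_sqrtr.
(* Cauchy-Schwarz: the sum of the squares of [a i * Y - b i * X] equals 2XY(XY - S), with S the
   inner product. This settles XY > 0; if XY = 0, one of the two vectors vanishes. *)
have AB : \sum_(i < d) a i * b i <= X * Y.
  have H : 0 <= \sum_(i < d) (a i * Y - b i * X) ^+ 2.
    by apply: sumr_ge0 => i _; exact: sqr_ge0.
  have : \sum_(i < d) (a i * Y - b i * X) ^+ 2 =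
      2 * (X * Y) * (X * Y - \sum_(i < d) a i * b i).
    transitivity (A * Y ^+ 2 + B * X ^+ 2 - (2 * X * Y) * \sum_(i < d) a i * b i).
      rewrite /A /B !mulr_suml mulr_sumr -big_split -sumrB.
      by apply: eq_bigr => i _; rewrite /=; ring.
    by rewrite -XA -YB; ring.
  move=> HE; rewrite HE in H.
  have [XY0|XY0] := ltP 0 (X * Y).
    by rewrite -subr_ge0 -(pmulr_rge0 _ (_ : 0 < 2 * (X * Y)))// mulr_gt0.
  have {}XY0 : X * Y = 0 by apply/eqP; rewrite eq_le XY0 mulr_ge0.
  rewrite XY0; move/eqP : XY0; rewrite mulf_eq0 => /orP[|] /eqP XY0.
    have /psumr_eq0P aE : A = 0 by rewrite -XA XY0 expr0n.
    rewrite big1// => i _.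
    have /eqP : a i ^+ 2 = 0 by apply: aE => // j _; exact: sqr_ge0.
    by rewrite sqrf_eq0 => /eqP ->; rewrite mul0r.
  have /psumr_eq0P aE : B = 0 by rewrite -YB XY0 expr0n.
  rewrite big1// => i _.
  have /eqP : b i ^+ 2 = 0 by apply: aE => // j _; exact: sqr_ge0.
  by rewrite sqrf_eq0 => /eqP ->; rewrite mulr0.
rewrite -(@ler_pXn2r _ 2)// ?nnegrE ?sqrtr_ge0 ?addr_ge0//.
rewrite sqr_sqrtr; last by apply: sumr_ge0 => i _; exact: sqr_ge0.
have -> : \sum_(i < d) (a i + b i) ^+ 2 = A + B + 2 * \sum_(i < d) a i * b i.
  rewrite /A /B mulr_sumr -!big_split.
  by apply: eq_bigr => i _; rewrite /=; ring.
rewrite -/X -/Y sqrrD XA YB -mulr_natl; lra.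
Qed.

End euclidean.

Section ball_measure.
Context {R : realType}.
Local Notation mR := (measurableTypeR R).

(** A cube is a product, so its measure follows by induction on the dimension. Squeezing a ball
    between two cubes bounds its volume on both sides without the volume of the unit ball. *)
Let cube d (y : d.-tuple mR) (r : R) : set (d.-tuple mR) :=
  [set x | forall i, `|tnth x i - tnth y i : R| < r].

Let measurable_cube d (y : d.-tuple mR) r : measurable (cube y r).
Proof.
have -> : cube y r =
    \bigcap_(i in [set: 'I_d]) ((fun x => tnth x i) @^-1` `]tnth y i - r, tnth y i + r[).
  apply/seteqP; split=> x /= + i => /(_ i).
    by move=> + _ /=; rewrite ltr_distl in_itv.
  by move=> /(_ I) /=; rewrite ltr_distl in_itv.
apply: fin_bigcap_measurable => // i _.
rewrite -[X in measurable X]setTI; apply: (measurable_tnth i) => //.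
Qed.

Let borel_lebesgue_cube d (y : d.-tuple mR) r : 0 < r ->
  borel_lebesgue d (cube y r) = ((2 * r) ^+ d)%:E.
Proof.
move=> r0; elim: d y => [|d IH] y /=.
  rewrite expr0 diracE (_ : _ \in _)//.
  by apply/mem_set => -[].
pose y' := [tuple of behead y].
rewrite /borel_step /pushforward.
have yE i : tnth y (lift ord0 i) = tnth y' i by rewrite !(tnth_nth 0)/= nth_behead.
have tE a (b : d.-tuple mR) i : tnth (tcons (a, b)) (lift ord0 i) = tnth b i.
  by rewrite !(tnth_nth 0).
have -> : tcons (d := d) @^-1` cube y r = `]thead y - r, thead y + r[ `*` cube y' r.
  apply/seteqP; split=> -[a b] /=.
    move=> H; split; first by have := H ord0; rewrite /= ltr_distl in_itv.
    by move=> i; have := H (lift ord0 i); rewrite yE tE.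
  move=> [+ H] i; rewrite in_itv/= -ltr_distl.
  by case: (unliftP ord0 i) => [j|] ->//; rewrite yE tE.
rewrite product_measure1E//; last exact: measurable_cube.
have L : lebesgue_measure (`]thead y - r, thead y + r[%classic : set R) = (2 * r)%:E.
  rewrite lebesgue_measure_itv/= lte_fin ifT; last lra.
  by rewrite -EFinB; congr _%:E; lra.
transitivity ((2 * r)%:E * ((2 * r) ^+ d)%:E)%E; last by rewrite -EFinM exprS.
by congr (_ * _)%E; [exact: L | exact: IH].
Qed.

Let ball_sub_cube d (y : Rd R d) r : @eball R d y r `<=` cube y r.
Proof.
move=> x xr i; apply: le_lt_trans xr.
rewrite -sqrtr_sqr; apply: ler_wsqrtr.
rewrite (bigD1 i)//= lerDl; apply: sumr_ge0 => j _; exact: sqr_ge0.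
Qed.

(** The d squares are each at most r^2/(d+1)^2, and d < (d+1)^2. Dividing by d+1 rather than d keeps
    the bound strict and covers d = 0. *)
Let cube_sub_ball d (y : Rd R d) r : 0 < r ->
  cube y (r / d.+1%:R) `<=` @eball R d y r.
Proof.
move=> r0 x xr; rewrite /eball/=.
have H : \sum_(i < d) ((tnth x i : R) - (tnth y i : R)) ^+ 2 < r ^+ 2.
  apply: (@le_lt_trans _ _ (\sum_(i < d) (r / d.+1%:R) ^+ 2)).
    apply: ler_sum => i _; rewrite -real_normK ?num_real//.
    by rewrite ler_pXn2r ?nnegrE// ?divr_ge0//; exact/ltW.
  rewrite sumr_const card_ord -(mulr_natl _ d) exprMn mulrCA. rewrite gtr_pMr ?exprn_gt0//.
  rewrite exprVn ltr_pdivrMr ?exprn_gt0// mul1r expr2 -natrM ltr_nat; nia.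
rewrite -(@ltr_pXn2r _ 2)// ?nnegrE ?sqrtr_ge0 ?(ltW r0)// sqr_sqrtr//.
by apply: sumr_ge0 => j _; exact: sqr_ge0.
Qed.

Lemma measurable_eball d (y : Rd R d) r : measurable (@eball R d y r).
Proof.
have m : measurable_fun setT (fun x : Rd R d => @Defs.edist R d x y).
  exact: (measurable_fun_pair1 y (@measurable_edist R d)).
rewrite (_ : eball _ _ = (fun x => @Defs.edist R d x y) @^-1` `]-oo, r[); last first.
  by apply/seteqP; split=> x; rewrite /= in_itv.
rewrite -[X in measurable X]setTI; exact: m.
Qed.

Lemma leb_eball_le d (y : Rd R d) r : 0 < r ->
  (leb (eball y r) <= (2 ^+ d * r `^ d%:R)%:E)%E.
Proof.
move=> r0; apply: (@le_trans _ _ (leb (cube y r : set (Rd R d)))).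
  apply: le_measure; rewrite ?inE; first exact: measurable_eball.
    exact: measurable_borel_Rd.
  exact: ball_sub_cube.
rewrite (leb_borel (measurable_cube y r)) borel_lebesgue_cube//.
by rewrite powR_mulrn ?(ltW r0)// exprMn.
Qed.

Lemma leb_eball_ge d (y : Rd R d) r : 0 < r ->
  (((2 / d.+1%:R) ^+ d * r `^ d%:R)%:E <= leb (eball y r))%E.
Proof.
move=> r0; apply: (@le_trans _ _ (leb (cube y (r / d.+1%:R) : set (Rd R d)))).
  rewrite (leb_borel (measurable_cube _ _)) borel_lebesgue_cube ?divr_gt0//.
  by rewrite powR_mulrn ?(ltW r0)// -exprMn mulrAC mulrA.
apply: le_measure; rewrite ?inE; last exact: cube_sub_ball.
  exact: measurable_borel_Rd.
exact: measurable_eball.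
Qed.

End ball_measure.

(** * Integrals and series of nonnegative terms *)

Section nonneg_integral.
Context {disp} {T : measurableType disp} {R : realType}.
Local Open Scope ereal_scope.

(* The integral of a nonnegative function is a supremum over the simple functions
   below it, hence it is monotone even off the measurable functions; this matters
   because [phi] is an arbitrary function. *)
Lemma le_integral_ge0 (mu : {measure set T -> \bar R}) (A : set T)
    (f g : T -> \bar R) :
  (forall x, A x -> 0 <= f x) -> (forall x, A x -> f x <= g x) ->
  \int[mu]_(x in A) f x <= \int[mu]_(x in A) g x.
Proof.
move=> f0 fg; rewrite !ge0_integralE//; last first.
  by move=> x Ax; apply: le_trans (fg _ Ax); exact: f0.
apply: le_ereal_sup => _ [h /= hf <-]; exists h => // x; apply: le_trans (hf x) _.
by rewrite /patch; case: ifPn => // /set_mem; exact: fg.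
Qed.

Lemma nneseries_le (u : nat -> \bar R) b : (forall i, 0 <= u i) ->
  (forall n, \sum_(i < n) u i <= b) -> \sum_(i <oo) u i <= b.
Proof.
move=> u0 ub; apply: lime_le; first exact: is_cvg_nneseries.
by apply: nearW => n; rewrite big_mkord.
Qed.

Lemma le_nneseries_term (u : nat -> \bar R) j : (forall i, 0 <= u i) ->
  u j <= \sum_(i <oo) u i.
Proof.
by move=> u0; rewrite (@nneseriesD1 _ _ j xpredT)// leeDl// nneseries_ge0.
Qed.

End nonneg_integral.

Section scalars.
Context {R : realType}.
Implicit Types a b s e r t : R.

Lemma powR_exprn s e j : 0 <= s -> (s ^+ j) `^ e = (s `^ e) ^+ j :> R.
Proof. by move=> s0; rewrite -powR_mulrn// -powRrM mulrC powRrM powR_mulrn// powR_ge0. Qed.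

Lemma powR_divr a b r : 0 <= a -> 0 <= b -> (a / b) `^ r = a `^ r / b `^ r.
Proof.
move=> a0 b0; rewrite powRM ?invr_ge0//; congr (_ * _).
by rewrite -powR_inv1// -!powRrM mulrC powRrM powR_inv1// powR_ge0.
Qed.

Lemma le_powR a b r : 0 <= r -> 0 <= a -> a <= b -> a `^ r <= b `^ r.
Proof.
by move=> r0 a0 ab; apply: ge0_ler_powR; rewrite ?nnegrE// (le_trans a0).
Qed.

Lemma lt_powR a b r : 0 < r -> 0 <= a -> a < b -> a `^ r < b `^ r.
Proof.
by move=> r0 a0 ab; apply: gt0_ltr_powR; rewrite ?nnegrE// ltW// (le_lt_trans a0).
Qed.

Lemma ge_powR s t e : e <= 0 -> 0 < s -> s <= t -> t `^ e <= s `^ e.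
Proof.
move=> e0 s0 st; rewrite -(opprK e) !(powRN _ (- e)).
rewrite lef_pV2 ?posrE ?powR_gt0 ?(lt_le_trans s0)//.
by apply: le_powR => //; [rewrite oppr_ge0|exact: ltW].
Qed.

Lemma powRK a r : r != 0 -> 0 <= a -> (a `^ r) `^ r^-1 = a.
Proof. by move=> r0 a0; rewrite -powRrM mulfV// powRr1. Qed.

Lemma sum_geometric_le a s n : 0 <= a -> 0 <= s -> s < 1 ->
  \sum_(i < n) a * s ^+ i <= a / (1 - s).
Proof.
move=> a0 s0 s1; rewrite -mulr_sumr ler_wpM2l//.
rewrite -[X in _ <= X]mul1r ler_pdivlMr ?subr_gt0//.
have := subrX1 s n; set S := \sum_(i < n) s ^+ i => E.
have -> : S * (1 - s) = 1 - s ^+ n by rewrite -[1 - s]opprB mulrN mulrC -E opprB.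
by rewrite gerBl exprn_ge0.
Qed.

Lemma nneseries_geometric_le a s : 0 <= a -> 0 <= s -> s < 1 ->
  (\sum_(i <oo) (a * s ^+ i)%:E <= (a / (1 - s))%:E)%E.
Proof.
move=> a0 s0 s1; apply: nneseries_le.
  by move=> i; rewrite lee_fin mulr_ge0// exprn_ge0.
by move=> n; rewrite sumEFin lee_fin sum_geometric_le.
Qed.

Lemma exists_exprn2_gt a : exists n, a < 2 ^+ n.
Proof.
have [n an] : exists n : nat, a < n%:R.
  by exists (Num.truncn `|a|).+1; apply: le_lt_trans (ler_norm _) _; exact: truncnS_gt.
exists n; apply: lt_le_trans an _; rewrite -natrX ler_nat; exact/ltnW/ltn_expl.
Qed.

(** [j] is the least exponent with [t < r * 2 ^+ j]. Minimality gives the lower bound when [j] is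
    positive, and [r <= 2 * t] gives it when [j] is 0. *)
Lemma exists_shell_up r t : 0 < r -> r <= 2 * t ->
  exists j, r * 2 ^+ j / 2 <= t < r * 2 ^+ j.
Proof.
move=> r0 rt; have ex := exists_exprn2_gt (t / r); case: (ex_minnP ex) => -[|j] jP jmin.
  exists 0; rewrite expr0 mulr1; rewrite expr0 ltr_pdivrMr// mul1r in jP.
  by rewrite jP ler_pdivrMr// mulrC rt.
exists j.+1; rewrite [X in _ && X](_ : _ = true) ?andbT; last first.
  by rewrite mulrC -ltr_pdivrMr.
have : ~~ (t / r < 2 ^+ j) by apply/negP => /jmin; rewrite ltnn.
by rewrite -leNgt ler_pdivlMr// exprS => ?; lra.
Qed.

(** The least n with r/t at most 2^n is positive because [t < r]; the shell index is n - 1. *)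
Lemma exists_shell_down r t : 0 < t -> t < r ->
  exists j, r * 2^-1 ^+ j / 2 <= t < r * 2^-1 ^+ j.
Proof.
move=> t0 tr; have ex : exists n, r / t <= 2 ^+ n.
  by have [n /ltW] := exists_exprn2_gt (r / t); exists n.
case: (ex_minnP ex) => -[|j] jP jmin.
  by move: jP; rewrite expr0 ler_pdivrMr// mul1r leNgt tr.
exists j; rewrite exprVn ler_pdivrMr// ler_pdivrMr ?exprn_gt0//.
rewrite ltr_pdivlMr ?exprn_gt0//.
rewrite ler_pdivrMr// exprS in jP.
have : ~~ (r / t <= 2 ^+ j) by apply/negP => /jmin; rewrite ltnn.
rewrite -ltNge ltr_pdivlMr// => H; apply/andP; split; first by rewrite -mulrA mulrC.
by rewrite mulrC.
Qed.

End scalars.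

(** * Potentials on Ahlfors-regular spaces *)

Section potential.
Context {disp} {T : measurableType disp} {R : realType}.
Variable dist : T -> T -> R.

Definition dball x (r : R) : set T := [set y | dist y x < r].

(** [D] plays the role of the dimension. Measurability of the distance is asked jointly in both
    variables, so that ball masses and potentials are sections to which Tonelli's theorem
    applies. *)
Record ahlfors_regular (mu : {measure set T -> \bar R}) (D c0 c1 : R) : Prop :=
  AhlforsRegular {
    dim_gt0 : 0 < D;
    c0_gt0 : 0 < c0;
    c1_gt0 : 0 < c1;
    dist_ge0 : forall x y, 0 <= dist x y;
    distC : forall x y, dist x y = dist y x;
    dist_triangle : forall x y z, dist x z <= dist x y + dist y z;
    measurable_dist : measurable_fun setT (fun u : T * T => dist u.1 u.2);
    ball_ge : forall x r, 0 < r -> ((c0 * r `^ D)%:E <= mu (dball x r))%E;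
    ball_le : forall x r, 0 < r -> (mu (dball x r) <= (c1 * r `^ D)%:E)%E }.

Variables (mu : {sigma_finite_measure set T -> \bar R}) (D c0 c1 : R).
Hypothesis reg : ahlfors_regular mu D c0 c1.

Definition kernel (a : R) x y : R := (dist x y `^ (D - a))^-1.

Definition mass (F : T -> R) x (t : R) : \bar R :=
  (\int[mu]_y (F y * \1_(dball x t) y)%:E)%E.

Definition potential (a : R) (F : T -> R) x : \bar R :=
  (\int[mu]_y (F y * kernel a x y)%:E)%E.

Lemma measurable_dist2 x : measurable_fun setT (dist x).
Proof. exact: (measurable_fun_pair2 x (measurable_dist reg)). Qed.

Lemma measurable_dball x r : measurable (dball x r).
Proof.
rewrite (_ : dball _ _ = dist x @^-1` `]-oo, r[); last first.
  by apply/seteqP; split=> y; rewrite /dball /= (distC reg) in_itv.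
rewrite -[X in measurable X]setTI; exact: measurable_dist2.
Qed.

Lemma measurable_kernel a : measurable_fun setT (fun u : T * T => kernel a u.1 u.2).
Proof.
under eq_fun do rewrite /kernel -powRN.
exact: (measurableT_comp (measurable_powR _) (measurable_dist reg)).
Qed.

Lemma measurable_kernel2 a x : measurable_fun setT (kernel a x).
Proof. exact: (measurable_fun_pair2 x (measurable_kernel a)). Qed.

Lemma kernel_ge0 a x y : 0 <= kernel a x y.
Proof. by rewrite invr_ge0 powR_ge0. Qed.

Lemma kernelC a x y : kernel a x y = kernel a y x.
Proof. by rewrite /kernel (distC reg). Qed.

(** With 0 to a nonzero power equal to 0, and the inverse of 0 equal to 0, the kernel vanishes on
    the diagonal instead of being infinite. The dyadic shells therefore have to cover positive
    distances only. *)
Lemma kernel0 (a : R) x y : a < D -> dist x y = 0 -> kernel a x y = 0.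
Proof. by move=> aD xy; rewrite /kernel xy powR0 ?invr0// subr_eq0 gt_eqF. Qed.

Lemma kernel_le (a : R) x y (r : R) : a < D -> 0 < r -> r <= dist x y ->
  kernel a x y <= r `^ (a - D).
Proof.
move=> aD r0 rxy; rewrite -opprB powRN lef_pV2 ?posrE ?powR_gt0//.
  by apply: le_powR => //; [rewrite subr_ge0 ltW|exact: ltW].
exact: lt_le_trans rxy.
Qed.

Lemma mass_ge0 (F : T -> R) x t : (forall y, 0 <= F y) -> (0 <= mass F x t)%E.
Proof. by move=> F0; apply: integral_ge0 => y _; rewrite lee_fin mulr_ge0. Qed.

Lemma measurable_mass_integrand (F : T -> R) x t : measurable_fun setT F ->
  measurable_fun setT (fun y => (F y * \1_(dball x t) y)%:E).
Proof.
move=> mF; apply/measurable_EFinP; apply: measurable_funM => //.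
by apply: measurable_indic; exact: measurable_dball.
Qed.

Lemma measurable_potential_integrand a (F : T -> R) x : measurable_fun setT F ->
  measurable_fun setT (fun y => (F y * kernel a x y)%:E).
Proof.
move=> mF; apply/measurable_EFinP; apply: measurable_funM => //.
exact: measurable_kernel2.
Qed.

(** Common core of the near estimate (s = 1/2) and the far one (s = 2). On the j-th shell the kernel
    is at most (rho s^j / 2)^(a - D); enlarging the shell to its ball, the mass bound makes the
    contributions geometric with ratio s^(a + e). *)
Lemma potential_shells (a : R) (F : T -> R) x (rho s e A : R) :
  0 < a -> a < D -> measurable_fun setT F -> (forall y, 0 <= F y) ->
  0 < rho -> 0 < s -> s `^ (a + e) < 1 -> 0 <= A ->
  (forall y, F y != 0 -> 0 < dist x y ->
    exists j, rho * s ^+ j / 2 <= dist x y < rho * s ^+ j) ->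
  (forall j, mass F x (rho * s ^+ j)%R <= (A * (rho * s ^+ j) `^ (D + e))%:E)%E ->
  (potential a F x <=
    (A * 2 `^ (D - a) / (1 - s `^ (a + e)) * rho `^ (a + e))%:E)%E.
Proof.
move=> a0 aD mF F0 rho0 s0 s1 A0 shell massF.
have r0 j : 0 < rho * s ^+ j by rewrite mulr_gt0 ?exprn_gt0.
pose k j : R := (rho * s ^+ j / 2) `^ (a - D).
pose g j y : \bar R := ((k j)%:E * (F y * \1_(dball x (rho * s ^+ j)) y)%:E)%E.
have k0 j : 0 <= k j by exact: powR_ge0.
have g0 j y : (0 <= g j y)%E.
  by rewrite /g -EFinM lee_fin !mulr_ge0.
apply: (@le_trans _ _ (\int[mu]_y \sum_(j <oo) g j y)%E).
  apply: le_integral_ge0 => y _; first by rewrite lee_fin mulr_ge0// kernel_ge0.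
  have [Fy|Fy] := eqVneq (F y) 0.
    by rewrite Fy mul0r; exact: nneseries_ge0.
  have := dist_ge0 reg x y; rewrite le_eqVlt => /predU1P[/esym xy|xy].
    by rewrite kernel0// mulr0; exact: nneseries_ge0.
  have [j /andP[j1 j2]] := shell y Fy xy.
  apply: le_trans (le_nneseries_term j (fun i => g0 i y)).
  rewrite /g -EFinM lee_fin indicE mem_set; last by rewrite /dball /= (distC reg).
  rewrite mulr1 mulrC ler_wpM2r//; apply: kernel_le => //.
  by rewrite divr_gt0.
rewrite integral_nneseries//; last first.
  by move=> j; apply: measurable_funeM; exact: measurable_mass_integrand.
apply: (@le_trans _ _ (\sum_(j <oo)
    (A * 2 `^ (D - a) * rho `^ (a + e) * (s `^ (a + e)) ^+ j)%:E)%E).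
  apply: lee_nneseries => [j _ _|j _]; first exact: integral_ge0.
  rewrite /g ge0_integralZl_EFin//; last 2 first.
  - by move=> y _; rewrite lee_fin mulr_ge0.
  - exact: measurable_mass_integrand.
  apply: (@le_trans _ _ ((k j)%:E * (A * (rho * s ^+ j) `^ (D + e))%:E)%E).
    by apply: lee_wpmul2l; [rewrite lee_fin|exact: massF].
  rewrite -EFinM lee_fin /k.
  rewrite powR_divr ?(ltW (r0 j))// -powR_exprn ?(ltW s0)// -[D - a]opprB powRN.
  rewrite -[X in _ <= X]mulrA -powRM ?exprn_ge0 ?(ltW s0) ?(ltW rho0)//.
  have -> : a + e = (a - D) + (D + e) by ring.
  rewrite (@powRD _ (rho * s ^+ j) (a - D)); last by rewrite (gt_eqF (r0 j)) implybT.
  by rewrite le_eqVlt; apply/predU1P; left; ring.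
apply: le_trans (nneseries_geometric_le _ _ s1) _.
- by rewrite !mulr_ge0 ?powR_ge0.
- exact: powR_ge0.
by rewrite lee_fin; rewrite le_eqVlt; apply/predU1P; left; ring.
Qed.

End potential.

(** * Near and far parts of a potential, and Hedberg's inequality *)

Section hedberg.
Context {disp} {T : measurableType disp} {R : realType}.
Variables (dist : T -> T -> R) (mu : {sigma_finite_measure set T -> \bar R}).
Variables (D c0 c1 : R).
Hypothesis reg : ahlfors_regular dist mu D c0 c1.
Implicit Types (F G : T -> R) (E : set T).

Local Notation ball := (dball dist).
Local Notation mass := (mass dist mu).
Local Notation potential := (potential dist mu D).

Lemma le_mass F G x (t : R) : (forall y, 0 <= F y) -> (forall y, F y <= G y) ->
  (mass F x t <= mass G x t)%E.
Proof.
move=> F0 FG; apply: le_integral_ge0 => y _; first by rewrite lee_fin mulr_ge0.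
by rewrite lee_fin ler_wpM2r.
Qed.

Lemma le_potential (a : R) F G x : (forall y, 0 <= F y) -> (forall y, F y <= G y) ->
  (potential a F x <= potential a G x)%E.
Proof.
move=> F0 FG; apply: le_integral_ge0 => y _.
  by rewrite lee_fin mulr_ge0// kernel_ge0.
by rewrite lee_fin ler_wpM2r// kernel_ge0.
Qed.

Lemma potential_ge0 (a : R) F x : (forall y, 0 <= F y) -> (0 <= potential a F x)%E.
Proof.
by move=> F0; apply: integral_ge0 => y _; rewrite lee_fin mulr_ge0// kernel_ge0.
Qed.

Definition restr F E y : R := F y * \1_E y.

Lemma measurable_restr F E : measurable_fun setT F -> measurable E ->
  measurable_fun setT (restr F E).
Proof. by move=> mF mE; apply: measurable_funM => //; exact: measurable_indic. Qed.

Lemma restr_ge0 F E y : (forall y, 0 <= F y) -> 0 <= restr F E y.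
Proof. by move=> F0; rewrite mulr_ge0. Qed.

Lemma restr_le F E y : (forall y, 0 <= F y) -> restr F E y <= F y.
Proof. by move=> F0; rewrite /restr ler_piMr// indicE; case: (_ \in _). Qed.

Lemma potential_split (a : R) F E x : measurable_fun setT F -> measurable E ->
  (forall y, 0 <= F y) ->
  potential a F x = (potential a (restr F E) x +
                     potential a (restr F (~` E)) x)%E.
Proof.
move=> mF mE F0; rewrite /potential /restr -ge0_integralD//.
- apply: eq_integral => y _; rewrite -EFinD -mulrDl -mulrDr.
  by rewrite !indicE in_setC; case: (_ \in _); rewrite ?(addr0, add0r) mulr1.
- by move=> y _; rewrite lee_fin !mulr_ge0// kernel_ge0.
- by apply: (measurable_potential_integrand reg); exact: measurable_restr.
- by move=> y _; rewrite lee_fin !mulr_ge0// kernel_ge0.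
- apply: (measurable_potential_integrand reg); apply: measurable_restr => //.
  exact: measurableC.
Qed.

(** These are the geometric sums of [potential_shells]: [near_cst] for s = 1/2 and e = 0, [far_cst]
    for s = 2 and e = b. *)
Definition near_cst (a : R) : R := 2 `^ (D - a) / (1 - 2^-1 `^ a).
Definition far_cst (a b : R) : R := 2 `^ (D - a) / (1 - 2 `^ (a + b)).

Lemma half_powR_lt1 (a : R) : 0 < a -> 2^-1 `^ a < 1 :> R.
Proof. by move=> a0; have := @lt_powR R 2^-1 1 a a0; rewrite powR1; apply; lra. Qed.

Lemma two_powR_lt1 (e : R) : e < 0 -> 2 `^ e < 1 :> R.
Proof.
move=> e0; rewrite -[e]opprK powRN invf_lt1 ?powR_gt0//.
by have := @lt_powR R 1 2 (- e); rewrite powR1; apply; lra.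
Qed.

Lemma near_cst_gt0 (a : R) : 0 < a -> 0 < near_cst a.
Proof. by move=> a0; rewrite divr_gt0 ?powR_gt0// subr_gt0 half_powR_lt1. Qed.

Lemma far_cst_gt0 (a b : R) : a + b < 0 -> 0 < far_cst a b.
Proof. by move=> a0; rewrite divr_gt0 ?powR_gt0// subr_gt0 two_powR_lt1. Qed.

Section bounds.
Variable a : R.
Hypotheses (a0 : 0 < a) (aD : a < D).

Lemma potential_near F x (rho A : R) :
  measurable_fun setT F -> (forall y, 0 <= F y) -> 0 < rho -> 0 <= A ->
  (forall y, F y != 0 -> dist x y < rho) ->
  (forall t, 0 < t -> (mass F x t <= (A * t `^ D)%:E)%E) ->
  (potential a F x <= (A * near_cst a * rho `^ a)%:E)%E.
Proof.
move=> mF F0 rho0 A0 Frho massF.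
have := potential_shells reg (a := a) (F := F) (x := x) (rho := rho)
  (s := 2^-1) (e := 0) (A := A).
rewrite !addr0 /near_cst mulrA; apply => //.
- exact: half_powR_lt1.
- by move=> y Fy xy; apply: exists_shell_down => //; exact: Frho.
- by move=> j; apply: massF; rewrite mulr_gt0// exprn_gt0.
Qed.

Lemma potential_far F x (rho A b : R) :
  measurable_fun setT F -> (forall y, 0 <= F y) -> 0 < rho -> 0 <= A ->
  a + b < 0 ->
  (forall y, F y != 0 -> rho <= dist x y) ->
  (forall t, 0 < t -> (mass F x t <= (A * t `^ (D + b))%:E)%E) ->
  (potential a F x <= (A * far_cst a b * rho `^ (a + b))%:E)%E.
Proof.
move=> mF F0 rho0 A0 ab0 Frho massF.
(* The first shell has outer radius [2 * rho], hence inner radius [rho]. As [a + b < 0], the extra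
   factor 2^(a + b) is at most 1. *)
apply: (@le_trans _ _ (A * far_cst a b * (2 * rho) `^ (a + b))%:E); last first.
  rewrite lee_fin ler_wpM2l//; first by rewrite mulr_ge0// ltW// far_cst_gt0.
  rewrite powRM ?(ltW rho0)// ler_piMl ?powR_ge0//.
  by rewrite ltW// two_powR_lt1.
rewrite /far_cst mulrA.
apply: (potential_shells reg) => //.
- by rewrite mulr_gt0.
- exact: two_powR_lt1.
- move=> y Fy xy; apply: exists_shell_up; first by rewrite mulr_gt0.
  by rewrite ler_pM2l//; exact: Frho.
- by move=> j; apply: massF; rewrite !mulr_gt0// exprn_gt0.
Qed.

Lemma potential_near_far F x (rho A b : R) :
  measurable_fun setT F -> (forall y, 0 <= F y) -> 0 < rho -> 0 <= A ->
  a + b < 0 ->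
  (forall t, 0 < t -> (mass F x t <= (A * t `^ (D + b))%:E)%E) ->
  (potential a F x <= potential a (restr F (ball x rho)) x +
    (A * far_cst a b * rho `^ (a + b))%:E)%E.
Proof.
move=> mF F0 rho0 A0 ab0 massF.
rewrite (potential_split a x mF (measurable_dball reg x rho))//.
apply: leeD2l; apply: potential_far => //.
- apply: measurable_restr => //; apply: measurableC; exact: (measurable_dball reg).
- by move=> y; exact: restr_ge0.
- move=> y; rewrite /restr indicE in_setC; case: (boolP (y \in _)); rewrite ?mulr0 ?eqxx//.
  move=> /negP yB _; rewrite leNgt (distC reg); apply/negP => xy.
  by apply: yB; exact/mem_set.
- move=> t t0; apply: le_trans (massF t t0); apply: le_mass => y.
    exact: restr_ge0.
  exact: restr_le.
Qed.

(* Hedberg's inequality, with [m] in the role of the maximal function of [F] at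
   [x]: the two parts balance at [rho = m `^ b^-1]. *)
Lemma hedberg F x (m A b : R) :
  measurable_fun setT F -> (forall y, 0 <= F y) -> 0 < m -> 0 <= A ->
  a + b < 0 ->
  (forall t, 0 < t -> (mass F x t <= (m * t `^ D)%:E)%E) ->
  (forall t, 0 < t -> (mass F x t <= (A * t `^ (D + b))%:E)%E) ->
  (potential a F x <= ((near_cst a + A * far_cst a b) * m `^ (1 + a / b))%:E)%E.
Proof.
move=> mF F0 m0 A0 ab0 mm massF.
have bn : b < 0 by move: a0 ab0; lra.
have b0 : b != 0 by rewrite lt_eqF.
pose rho := m `^ b^-1.
have rho0 : 0 < rho by exact: powR_gt0.
apply: le_trans (potential_near_far mF F0 rho0 A0 ab0 massF) _.
have E1 : rho `^ (a + b) = m `^ (1 + a / b).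
  by rewrite -powRrM; congr (_ `^ _); rewrite mulrC mulrDl divff// addrC.
have E2 : m * rho `^ a = m `^ (1 + a / b).
  rewrite -powRrM powRD ?(gt_eqF m0) ?implybT// powRr1 ?(ltW m0)//.
  by rewrite [b^-1 * a]mulrC.
rewrite E1 mulrDl EFinD; apply: leeD => //.
have -> : near_cst a * m `^ (1 + a / b) = m * near_cst a * rho `^ a.
  by rewrite -E2; ring.
apply: potential_near => //.
- by apply: measurable_restr => //; exact: (measurable_dball reg).
- by move=> y; exact: restr_ge0.
- exact: ltW.
- move=> y; rewrite /restr indicE; case: (boolP (y \in _)); rewrite ?mulr0 ?eqxx//.
  by move=> /set_mem; rewrite /dball /= (distC reg).
- move=> t t0; apply: le_trans (mm t t0); apply: le_mass => y.
    exact: restr_ge0.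
  exact: restr_le.
Qed.

End bounds.

(** For u above l, write u as u^(1 - q) u^q and use that the exponent 1 - q is negative. *)
Lemma le_young_powR (q l u : R) : 1 < q -> 0 < l -> 0 <= u ->
  u <= l + l `^ (1 - q) * u `^ q.
Proof.
move=> q1 l0 u0; have [ul|lu] := leP u l.
  by rewrite (le_trans ul)// lerDl mulr_ge0 ?powR_ge0.
have {}u0 : 0 < u by exact: lt_trans lu.
apply: (@le_trans _ _ (l `^ (1 - q) * u `^ q)); last by rewrite lerDr ltW.
rewrite -[X in X <= _]powRr1 ?(ltW u0)// -{1}(subrK q 1).
rewrite powRD ?(gt_eqF u0) ?implybT// ler_wpM2r ?powR_ge0//.
rewrite -[1 - q]opprB !powRN lef_pV2 ?posrE ?powR_gt0//.
by apply: le_powR; rewrite ?subr_ge0 ltW.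
Qed.

(* A substitute for Hoelder's inequality on balls. *)
Lemma mass_le_powR F (q l b : R) x (t : R) : 1 < q -> 0 < l -> 0 <= b -> 0 < t ->
  measurable_fun setT F -> (forall y, 0 <= F y) ->
  (mass (fun y => F y `^ q)%R x t <= (l `^ q * b * t `^ D)%:E)%E ->
  (mass F x t <= (l * (c1 + b) * t `^ D)%:E)%E.
Proof.
move=> q1 l0 b0 t0 mF F0 mq.
have mFq : measurable_fun setT (fun y => F y `^ q).
  exact: (measurableT_comp (measurable_powR q) mF).
(* [le_young_powR] is integrated over the ball. With a q-mass of at most l^q b t^D, the two terms
   are at most l c1 t^D and l b t^D. *)
apply: (@le_trans _ _ (\int[mu]_y (l%:E * (\1_(ball x t) y)%:E +
    (l `^ (1 - q))%:E * (F y `^ q * \1_(ball x t) y)%:E))%E).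
  apply: le_integral_ge0 => y _; first by rewrite lee_fin mulr_ge0.
  rewrite -!EFinM -EFinD lee_fin mulrA -mulrDl ler_wpM2r//.
  exact: le_young_powR.
rewrite ge0_integralD//; last 4 first.
- by move=> y _; rewrite -EFinM lee_fin mulr_ge0// ltW.
- apply: measurable_funeM; apply/measurable_EFinP; apply: measurable_indic.
  exact: (measurable_dball reg).
- by move=> y _; rewrite -EFinM lee_fin !mulr_ge0// powR_ge0.
- by apply: measurable_funeM; exact: (measurable_mass_integrand reg).
rewrite ge0_integralZl_EFin//; last 2 first.
- apply/measurable_EFinP; apply: measurable_indic; exact: (measurable_dball reg).
- exact: ltW.
rewrite ge0_integralZl_EFin//; last 3 first.
- by move=> y _; rewrite lee_fin mulr_ge0// powR_ge0.
- exact: (measurable_mass_integrand reg).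
- exact: powR_ge0.
rewrite integral_indic//; last exact: (measurable_dball reg).
rewrite setIT.
apply: (@le_trans _ _ (l%:E * (c1 * t `^ D)%:E +
    (l `^ (1 - q))%:E * (l `^ q * b * t `^ D)%:E)%E).
  apply: leeD; apply: lee_wpmul2l; rewrite ?lee_fin ?powR_ge0 ?(ltW l0)//.
  exact: (ball_le reg).
rewrite -!EFinM -EFinD lee_fin.
have -> : l `^ (1 - q) * (l `^ q * b * t `^ D) = l * b * t `^ D.
  by rewrite !mulrA -powRD ?(gt_eqF l0) ?implybT// subrK powRr1// ltW.
by rewrite le_eqVlt; apply/predU1P; left; ring.
Qed.

End hedberg.

(** * Strong-type estimate *)

Section capped_sum.
Context {R : realType}.

(** The surviving terms are dominated by the largest of them, which is below [W]. For s < 1 it is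
    the first one below [W], reached by peeling off leading terms, so [w] varies in the induction;
    for s > 1 it is the last one. [C] is independent of [w], [W] and [n], which lets [W] depend on a
    point later. *)
Lemma sum_capped_geometric (s : R) : 0 < s -> s != 1 ->
  exists2 C : R, 0 < C & forall (w W : R) n, 0 < w -> 0 <= W ->
    \sum_(i < n) w * s ^+ i * (w * s ^+ i < W)%R%:R <= C * W.
Proof.
move=> s0 s1.
have ws i w : 0 < w -> 0 < w * s ^+ i by move=> w0; rewrite mulr_gt0 ?exprn_gt0.
have [{}s1|{}s1|s1'] := ltgtP s 1; last by rewrite s1' eqxx in s1.
- exists (1 - s)^-1; first by rewrite invr_gt0 subr_gt0.
  move=> w W n w0 W0; elim: n w w0 => [|n IH] w w0.
    by rewrite big_ord0 mulr_ge0// invr_ge0 subr_ge0 (ltW s1).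
  have [wW|Ww] := ltP w W.
    apply: (@le_trans _ _ (\sum_(i < n.+1) w * s ^+ i)).
      apply: ler_sum => i _; rewrite ler_piMr ?(ltW (ws _ _ w0))//.
      by case: (_ < _).
    apply: le_trans (sum_geometric_le _ (ltW w0) (ltW s0) s1) _.
    by rewrite mulrC ler_wpM2l ?(ltW wW)// invr_ge0 subr_ge0 (ltW s1).
  rewrite big_ord_recl expr0 mulr1 ltNge Ww mulr0 add0r.
  under eq_bigr do rewrite lift0 exprS mulrA.
  by apply: IH; rewrite mulr_gt0.
- exists (s / (s - 1)); first by rewrite divr_gt0 ?subr_gt0.
  move=> w W n w0 W0; elim: n => [|n IH].
    by rewrite big_ord0 mulr_ge0// divr_ge0 ?subr_ge0 ?(ltW s0) ?(ltW s1).
  have [wW|Ww] := ltP (w * s ^+ n) W; last first.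
    by rewrite big_ord_recr/= ltNge Ww mulr0 addr0.
  apply: (@le_trans _ _ (\sum_(i < n.+1) w * s ^+ i)).
    apply: ler_sum => i _; rewrite ler_piMr ?(ltW (ws _ _ w0))//.
    by case: (_ < _).
  rewrite -mulr_sumr mulrAC ler_pdivlMr ?subr_gt0// -mulrA [_ * (s - 1)]mulrC.
  rewrite -subrX1 exprS.
  by move: (ws n w w0) wW; nra.
Qed.

End capped_sum.

Section local.
Context {disp} {T : measurableType disp} {R : realType}.
Variables (dist : T -> T -> R) (mu : {sigma_finite_measure set T -> \bar R}).
Variables (D c0 c1 : R).
Hypothesis reg : ahlfors_regular dist mu D c0 c1.
Implicit Types (F G : T -> R) (E : set T).

Local Notation ball := (dball dist).
Local Notation mass := (mass dist mu).
Local Notation potential := (potential dist mu D).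
Local Notation kernel := (kernel dist D).

Lemma measurable_potential (a : R) F : measurable_fun setT F ->
  (forall y, 0 <= F y) -> measurable_fun setT (potential a F).
Proof.
move=> mF F0.
apply: (@measurable_fun_fubini_tonelli_F _ _ _ _ _ mu
  (fun u : T * T => (F u.2 * kernel a u.1 u.2)%:E)).
  apply/measurable_EFinP; apply: measurable_funM.
    exact: (measurableT_comp mF measurable_snd).
  exact: (measurable_kernel reg).
by move=> u; rewrite lee_fin mulr_ge0// kernel_ge0.
Qed.

Variable a : R.
Hypotheses (a0 : 0 < a) (aD : a < D).

Let pairker rho (F : T -> R) (u : T * T) : \bar R :=
  (F u.2 * \1_(ball u.1 rho) u.2 * kernel a u.1 u.2)%:E.

Lemma measurable_ball_pair rho :
  measurable_fun setT (fun u : T * T => \1_(ball u.1 rho) u.2 : R).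
Proof.
rewrite (_ : (fun u => _) = \1_((fun u => dist u.1 u.2) @^-1` `]-oo, rho[)).
  apply: measurable_indic; rewrite -[X in measurable X]setTI.
  exact: (measurable_dist reg).
apply/funext => u; rewrite !indicE; congr (_%:R); congr nat_of_bool.
by apply/idP/idP => /set_mem H; apply/mem_set; move: H;
  rewrite /dball /= (distC reg) in_itv.
Qed.

Let measurable_pairker rho F : measurable_fun setT F ->
  measurable_fun setT (pairker rho F).
Proof.
move=> mF; apply/measurable_EFinP; apply: measurable_funM.
  apply: measurable_funM; first exact: (measurableT_comp mF measurable_snd).
  exact: measurable_ball_pair.
exact: (measurable_kernel reg).
Qed.

Let pairker_ge0 rho F u : (forall y, 0 <= F y) -> (0 <= pairker rho F u)%E.
Proof. by move=> F0; rewrite lee_fin !mulr_ge0// kernel_ge0. Qed.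

Lemma measurable_potential_near rho F : measurable_fun setT F ->
  (forall y, 0 <= F y) ->
  measurable_fun setT (fun x => potential a (restr F (ball x rho)) x).
Proof.
move=> mF F0.
apply: (@measurable_fun_fubini_tonelli_F _ _ _ _ _ mu (pairker rho F)).
  exact: measurable_pairker.
by move=> u; exact: pairker_ge0.
Qed.

Lemma mass_bounded F (l : R) x t : 0 < t -> 0 <= l -> measurable_fun setT F ->
  (forall y, 0 <= F y) -> (forall y, F y <= l) ->
  (mass F x t <= (c1 * l * t `^ D)%:E)%E.
Proof.
move=> t0 l0 mF F0 Fl.
apply: (@le_trans _ _ (\int[mu]_y (l%:E * (\1_(ball x t) y)%:E))%E).
  apply: le_integral_ge0 => y _; first by rewrite lee_fin mulr_ge0.
  by rewrite -EFinM lee_fin ler_wpM2r.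
rewrite ge0_integralZl_EFin//; last first.
  apply/measurable_EFinP; apply: measurable_indic; exact: (measurable_dball reg).
rewrite integral_indic//; last exact: (measurable_dball reg).
rewrite setIT [c1 * l]mulrC -mulrA EFinM; apply: lee_wpmul2l; rewrite ?lee_fin//.
exact: (ball_le reg).
Qed.

(** By Tonelli and the symmetry of the kernel, the inner integral becomes the potential at [y] of
    the indicator of [ball y rho]. [potential_near] bounds it with growth constant [c1], the
    indicator being at most 1. *)
Lemma integral_potential_near rho F : 0 < rho -> measurable_fun setT F ->
  (forall y, 0 <= F y) ->
  (\int[mu]_x potential a (restr F (ball x rho)) x <=
    (c1 * near_cst D a * rho `^ a)%:E * \int[mu]_y (F y)%:E)%E.
Proof.
move=> rho0 mF F0.
rewrite [leLHS](@fubini_tonelli _ _ _ _ _ mu mu (pairker rho F)); last 2 first.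
- exact: measurable_pairker.
- by move=> u; exact: pairker_ge0.
have C0 : 0 <= c1 * near_cst D a * rho `^ a.
  have := near_cst_gt0 D a0; have := c1_gt0 reg => c1p np.
  by apply: mulr_ge0; [apply: mulr_ge0; exact: ltW|exact: powR_ge0].
rewrite -ge0_integralZl_EFin//; last 2 first.
- by move=> y _; rewrite lee_fin.
- exact/measurable_EFinP.
apply: le_integral_ge0 => y _.
  by apply: integral_ge0 => x _; exact: pairker_ge0.
have -> : (\int[mu]_x pairker rho F (x, y) =
    (F y)%:E * potential a (\1_(ball y rho)) y)%E.
  rewrite /potential -ge0_integralZl_EFin//; last 2 first.
  - by move=> x _; rewrite lee_fin mulr_ge0// kernel_ge0.
  - apply: (measurable_potential_integrand reg).
    by apply: measurable_indic; exact: (measurable_dball reg).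
  apply: eq_integral => x _; rewrite -EFinM /pairker/= (kernelC reg) mulrA.
  congr (_ * _ * _)%:E; rewrite !indicE; congr (_%:R); congr nat_of_bool.
  by apply/idP/idP => /set_mem H; apply/mem_set; move: H; rewrite /dball /= (distC reg).
rewrite muleC; apply: lee_wpmul2r; first by rewrite lee_fin.
apply: (potential_near reg) => //.
- by apply: measurable_indic; exact: (measurable_dball reg).
- exact/ltW/(c1_gt0 reg).
- move=> x; rewrite indicE; case: (boolP (x \in _)); rewrite ?eqxx//.
  by move=> /set_mem; rewrite /dball /= (distC reg).
- move=> t t0; rewrite -[c1]mulr1; apply: mass_bounded => //.
  by apply: measurable_indic; exact: (measurable_dball reg).
Qed.

(** Three regions: far from [x] the growth of the mass decides; near [x] with [G <= s] the function
    is bounded; the region near [x] with [G > s] is kept as the last term. *)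
Lemma potential_level G x (A b rho s : R) :
  measurable_fun setT G -> (forall y, 0 <= G y) -> 0 < rho -> 0 <= s -> 0 <= A ->
  a + b < 0 ->
  (forall t, 0 < t -> (mass G x t <= (A * t `^ (D + b))%:E)%E) ->
  (potential a G x <= (c1 * s * near_cst D a * rho `^ a)%:E +
     (A * far_cst D a b * rho `^ (a + b))%:E +
     potential a (restr (restr G [set y | (s < G y)%R]) (ball x rho)) x)%E.
Proof.
move=> mG G0 rho0 s0 A0 ab0 massG.
apply: le_trans (potential_near_far reg a0 aD mG G0 rho0 A0 ab0 massG) _.
rewrite [X in (_ <= X)%E]addeAC; apply: leeD2r.
pose E := [set y | (s < G y)%R].
have mE : measurable E.
  rewrite (_ : E = G @^-1` `]s, +oo[); last first.
    by apply/seteqP; split=> y; rewrite /E/= in_itv/= andbT.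
  by rewrite -[X in measurable X]setTI; exact: mG.
have mB := measurable_dball reg x rho.
rewrite (potential_split reg a x (measurable_restr mG mB) mE); last first.
  by move=> y; exact: restr_ge0.
rewrite [X in (X <= _)%E]addeC; apply: leeD; last first.
  apply: le_potential => y; first by rewrite !restr_ge0// => z; exact: restr_ge0.
  by rewrite /restr mulrAC.
apply: (potential_near reg) => //.
- by apply: measurable_restr; [exact: measurable_restr|exact: measurableC].
- by move=> y; rewrite !restr_ge0// => z; exact: restr_ge0.
- by rewrite mulr_ge0// ltW// (c1_gt0 reg).
- move=> y; rewrite /restr [\1_(ball _ _) _]indicE; case: (boolP (y \in _)).
    by move=> /set_mem; rewrite /dball /= (distC reg).
  by rewrite mulr0 mul0r eqxx.
- move=> t t0; apply: mass_bounded => //.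
  + by apply: measurable_restr; [exact: measurable_restr|exact: measurableC].
  + by move=> y; rewrite !restr_ge0// => z; exact: restr_ge0.
  move=> y; rewrite {1}/restr indicE in_setC; case: (boolP (y \in E)).
    by rewrite mulr0.
  move=> /negP yE; rewrite mulr1; apply: le_trans (restr_le _ _ G0) _.
  by rewrite leNgt; apply/negP => sG; apply: yE; exact/mem_set.
Qed.

End local.

Section strong_type.
Context {disp} {T : measurableType disp} {R : realType}.
Variables (dist : T -> T -> R) (mu : {sigma_finite_measure set T -> \bar R}).
Variables (D c0 c1 : R).
Hypothesis reg : ahlfors_regular dist mu D c0 c1.

Local Notation ball := (dball dist).
Local Notation mass := (mass dist mu).
Local Notation potential := (potential dist mu D).

Variables (a b q A : R).
Hypotheses (a0 : 0 < a) (aD : a < D) (ab0 : a + b < 0) (q1 : 1 < q) (A0 : 0 < A).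

Let th := 1 + a / b.
Let qb := q / th.

Let b0 : b < 0. Proof. by move: a0 ab0; lra. Qed.

Lemma exponent_gt0 : 0 < 1 + a / b.
Proof.
have -> : 1 + a / b = - (a + b) / - b.
  by rewrite invrN mulrNN mulrDl divff ?lt_eqF// addrC.
by rewrite divr_gt0 ?oppr_gt0.
Qed.

Let th0 : 0 < th. Proof. exact: exponent_gt0. Qed.
Let qb_gt0 : 0 < qb. Proof. by rewrite divr_gt0// (lt_trans _ q1). Qed.

Let n0 : 0 < near_cst D a. Proof. exact: near_cst_gt0. Qed.
Let f0 : 0 < far_cst D a b. Proof. exact: far_cst_gt0. Qed.
Let c10 : 0 < c1. Proof. exact: (c1_gt0 reg). Qed.

(* [radius l] makes the far part of the potential at most [l], and then
   [level l] is the height below which [G] contributes at most [l] to the near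
   part. *)
Let radius l := (l / (A * far_cst D a b)) `^ (a + b)^-1.
Let level l := l / (c1 * near_cst D a * radius l `^ a).
Let kappa := (A * far_cst D a b) `^ (a / (a + b)) / (c1 * near_cst D a).

Let radius_gt0 l : 0 < l -> 0 < radius l.
Proof. by move=> l0; rewrite powR_gt0// divr_gt0// mulr_gt0. Qed.

Let kappa_gt0 : 0 < kappa.
Proof. by apply: divr_gt0; [apply: powR_gt0|]; exact: mulr_gt0. Qed.

Let level_gt0 l : 0 < l -> 0 < level l.
Proof.
move=> l0; apply: divr_gt0 => //; apply: mulr_gt0; first exact: mulr_gt0.
exact/powR_gt0/radius_gt0.
Qed.

(** [radius l] is a multiple of l^(1/(a + b)), so [level l] is a multiple of l^(1 - a/(a + b)), and
    this exponent is b/(a + b) = 1/[th]. Hence l^[qb] is a multiple of ([level l])^q, which is how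
    [qb] fits the q-mass of [G]. *)
Let levelE l : 0 < l -> level l = kappa * l `^ th^-1.
Proof.
move=> l0; have Af0 : 0 < A * far_cst D a b by rewrite mulr_gt0.
have e : (a + b)^-1 * a = a / (a + b) by rewrite mulrC.
rewrite /level /radius -powRrM e powR_divr ?ltW//.
have -> : th^-1 = 1 - a / (a + b).
  by rewrite /th; field; rewrite ?lt_eqF//; apply/andP; split; rewrite // lt_eqF// addrC.
rewrite powRD ?(gt_eqF l0) ?implybT// powRr1 ?(ltW l0)// powRN /kappa.
have p1 := powR_gt0 (a / (a + b)) l0; have p2 := powR_gt0 (a / (a + b)) Af0.
field; rewrite !gt_eqF//.
Qed.

Let ratio s := (s `^ th^-1) `^ (q - 1).

Let ratio_gt0 s : 0 < s -> 0 < ratio s.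
Proof. by move=> s0; rewrite !powR_gt0. Qed.

Let ratio_neq1 s : 0 < s -> s != 1 -> ratio s != 1.
Proof.
move=> s0 s1; have e0 : 0 < th^-1 * (q - 1) by rewrite mulr_gt0 ?invr_gt0 ?subr_gt0.
rewrite /ratio -powRrM; have [s_lt|s_gt|s_eq] := ltgtP s 1; last by rewrite s_eq eqxx in s1.
  by rewrite lt_eqF//; have := lt_powR e0 (ltW s0) s_lt; rewrite powR1.
by rewrite gt_eqF//; have := lt_powR e0 ler01 s_gt; rewrite powR1.
Qed.

(** 8^[qb] comes from bounding the potential by the top [8 * l] of its layer, and kappa^(-q) from
    writing l^[qb] as kappa^(-q) ([level l])^q. *)
Let K := 8 `^ qb * kappa `^ (- q).

Let K0 : 0 < K. Proof. by rewrite mulr_gt0 ?powR_gt0. Qed.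

Section layers.
Variable G : T -> R.
Hypotheses (mG : measurable_fun setT G) (G0 : forall y, 0 <= G y).
Hypothesis massG :
  forall x t, 0 < t -> (mass G x t <= (A * t `^ (D + b))%:E)%E.

Let above l : T -> R := restr G [set y | (level l < G y)%R].
Let nearpot l x := potential a (restr (above l) (ball x (radius l))) x.
Let layer l x : \bar R := ((8 `^ qb * l `^ (qb - 1))%:E * nearpot l x)%E.

Let above_ge0 l y : 0 <= above l y. Proof. exact: restr_ge0. Qed.

Let measurable_above l : measurable_fun setT (above l).
Proof.
apply: measurable_restr => //.
rewrite (_ : [set _ | _] = G @^-1` `]level l, +oo[); last first.
  by apply/seteqP; split=> y; rewrite /= in_itv/= andbT.
by rewrite -[X in measurable X]setTI; exact: mG.
Qed.

Let nearpot_ge0 l x : (0 <= nearpot l x)%E.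
Proof. by apply: potential_ge0 => y; exact: restr_ge0. Qed.

Let cst_ge0 l : 0 <= 8 `^ qb * l `^ (qb - 1) :> R.
Proof. by rewrite mulr_ge0 ?powR_ge0. Qed.

Let layer_ge0 l x : (0 <= layer l x)%E.
Proof. by rewrite mule_ge0// lee_fin. Qed.

Let measurable_layer l : measurable_fun setT (layer l).
Proof. by apply: measurable_funeM; exact: (measurable_potential_near reg). Qed.

Let potential_le_nearpot l x : 0 < l ->
  (potential a G x <= (2 * l)%:E + nearpot l x)%E.
Proof.
move=> l0.
have := potential_level reg a0 aD mG G0 (radius_gt0 l0) (ltW (level_gt0 l0))
  (ltW A0) ab0 (massG x).
have r0 := radius_gt0 l0; have p0 := powR_gt0 a r0.
have -> : c1 * level l * near_cst D a * radius l `^ a = l.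
  by rewrite /level; field; rewrite !gt_eqF.
have -> : A * far_cst D a b * radius l `^ (a + b) = l.
  rewrite /radius -powRrM mulVf ?lt_eqF// powRr1; last first.
    by apply/ltW/divr_gt0 => //; exact: mulr_gt0.
  by rewrite mulrC divfK// gt_eqF// mulr_gt0.
by rewrite -EFinD; congr (_ <= _%:E + _)%E; ring.
Qed.

(** Let u and n be the values of the potential and of [nearpot l]. From 4l <= u <= 2l + n follows l
    <= n, so u^[qb] is at most (8l)^[qb], hence at most 8^[qb] l^([qb] - 1) n. This is linear in n,
    so an L^1 bound on [nearpot l] suffices. *)
Let potential_le_layer l x : 0 < l ->
  ((4 * l)%:E <= potential a G x < (8 * l)%:E)%E ->
  (potential a G x `^ qb <= layer l x)%E.
Proof.
move=> l0 /andP[]; have := potential_le_nearpot x l0; rewrite /layer.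
have : (0 <= potential a G x)%E by exact: potential_ge0.
case: (potential a G x) => [u u0| |]//.
have c_gt0 : 0 < 8 `^ qb * l `^ (qb - 1) :> R by rewrite mulr_gt0 ?powR_gt0.
have := nearpot_ge0 l x.
case: (nearpot l x) => [n _| _|//]; last first.
  by move=> *; rewrite gt0_muley ?lte_fin// leey.
rewrite -EFinD !lee_fin lte_fin => un lu ul.
apply: (@le_trans _ _ ((8 * l) `^ qb)); first by apply: le_powR => //; exact: ltW.
rewrite powRM ?(ltW l0)// -mulrA ler_wpM2l ?powR_ge0//.
rewrite -[X in l `^ X](subrK 1) powRD ?(gt_eqF l0) ?implybT// powRr1 ?(ltW l0)//.
by rewrite ler_wpM2l ?powR_ge0//; lra.
Qed.

Let layer_y l x : 0 < l -> potential a G x = +oo%E -> layer l x = +oo%E.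
Proof.
move=> l0 uy; have := potential_le_nearpot x l0; rewrite uy leye_eq /layer.
have := nearpot_ge0 l x; case: (nearpot l x) => // _ _.
by rewrite gt0_muley// lte_fin mulr_gt0 ?powR_gt0.
Qed.

(** A finite positive value lies in [4l, 8l) for some l of the form 2^j or 2^(-j), and that single
    layer is at most the sum. At an infinite value the layer l = 1 is already infinite. *)
Let potential_le_layers x : (potential a G x `^ qb <=
  \sum_(i <oo) layer (2 ^+ i)%R x + \sum_(i <oo) layer (2^-1 ^+ i)%R x)%E.
Proof.
have s0 (l : nat -> R) : (0 <= \sum_(i <oo) layer (l i) x)%E by exact: nneseries_ge0.
have := potential_ge0 dist mu D a x G0.
case uE : (potential a G x) => [u| |]// u0.
  move: u0; rewrite lee_fin le_eqVlt => /predU1P[<-|u0].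
    by rewrite poweR_EFin powR0 ?gt_eqF// adde_ge0.
  have [u8|u8] := leP 8 (2 * u).
    have e8 : 0 < 8 :> R by [].
    have [j /andP[j1 j2]] := exists_shell_up e8 u8.
    apply: (@le_trans _ _ (layer (2 ^+ j)%R x)).
      rewrite -uE; apply: potential_le_layer; first exact: exprn_gt0.
      by rewrite uE lee_fin lte_fin j2 andbT; lra.
    apply: le_trans (leeDl _ (s0 _)).
    exact: (le_nneseries_term (u := fun i => layer (2 ^+ i) x)).
  have {}u8 : u < 8 by lra.
  have [j /andP[j1 j2]] := exists_shell_down u0 u8.
  apply: (@le_trans _ _ (layer (2^-1 ^+ j)%R x)).
    rewrite -uE; apply: potential_le_layer; first exact: exprn_gt0.
    by rewrite uE lee_fin lte_fin j2 andbT; lra.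
  apply: le_trans (leeDr _ (s0 _)).
  exact: (le_nneseries_term (u := fun i => layer (2^-1 ^+ i) x)).
apply: le_trans (leeDl _ (s0 _)).
have l0y : layer (2 ^+ 0) x = +oo%E by apply: layer_y => //; exact: exprn_gt0.
rewrite [X in (X <= _)%E](_ : _ = layer (2 ^+ 0) x); last by rewrite l0y poweRyr// gt_eqF.
exact: (le_nneseries_term (u := fun i => layer (2 ^+ i) x)).
Qed.

Let integral_layer l : 0 < l ->
  (\int[mu]_x layer l x <=
    (8 `^ qb * kappa `^ (- q) * level l `^ (q - 1))%:E * \int[mu]_y (above l y)%:E)%E.
Proof.
move=> l0; rewrite /layer ge0_integralZl_EFin//; last first.
  exact: (measurable_potential_near reg).
have := integral_potential_near reg a0 aD (radius_gt0 l0) (measurable_above l)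
  (above_ge0 l).
move=> /(lee_wpmul2l (_ : 0 <= (8 `^ qb * l `^ (qb - 1))%:E)%E) H.
apply: le_trans (H _) _; first by rewrite lee_fin.
rewrite muleA -EFinM; apply: lee_wpmul2r.
  by apply: integral_ge0 => y _; rewrite lee_fin.
rewrite lee_fin -2!(mulrA (8 `^ qb)); apply: ler_wpM2l; first exact: powR_ge0.
have r0 := radius_gt0 l0; have p0 := powR_gt0 a r0; have lv0 := level_gt0 l0.
have -> : c1 * near_cst D a * radius l `^ a = l / level l.
  by rewrite /level; field; rewrite !gt_eqF.
rewrite mulrA -[X in _ * X / _]powRr1 ?(ltW l0)// -powRD; last first.
  by rewrite (gt_eqF l0) implybT.
rewrite subrK.
have -> : l `^ qb = kappa `^ (- q) * level l `^ q.
  rewrite levelE// powRM ?powR_ge0 ?(ltW kappa_gt0)// mulrA -powRD; last first.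
    by rewrite (gt_eqF kappa_gt0) implybT.
  by rewrite addNr powRr0 mul1r -powRrM mulrC.
rewrite -mulrA ler_wpM2l ?powR_ge0// powRD; last by rewrite (gt_eqF lv0) implybT.
by rewrite powRN powRr1// ltW.
Qed.

(** Once the sum is moved under the integral, only the indices with [level (s ^+ i) < G y] survive
    at [y]. The capped geometric sum with [W = G y]^ (q - 1)[, multiplied by the remaining factor]G
    y[, gives]G y [^ q]. *)
Let layers_sum s C : 0 < s ->
  (forall (w W : R) n, 0 < w -> 0 <= W ->
    \sum_(i < n) w * ratio s ^+ i * (w * ratio s ^+ i < W)%R%:R <= C * W) ->
  0 < C ->
  (\sum_(i <oo) \int[mu]_x layer (s ^+ i)%R x <=
    (K * C)%:E * \int[mu]_x (G x `^ q)%:E)%E.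
Proof.
move=> s0 HC C0; pose w := kappa `^ (q - 1); pose t := ratio s.
have w0 : 0 < w by exact: powR_gt0.
have t0 : 0 < t by exact: ratio_gt0.
have levE i : level (s ^+ i) `^ (q - 1) = w * t ^+ i.
  rewrite levelE ?exprn_gt0// powRM ?powR_ge0 ?(ltW kappa_gt0)//.
  by rewrite powR_exprn ?(ltW s0)// powR_exprn ?powR_ge0.
pose g i y := (K * (w * t ^+ i) * above (s ^+ i) y)%:E.
have g0 i y : (0 <= g i y)%E.
  by rewrite lee_fin mulr_ge0// mulr_ge0 ?ltW// mulr_gt0 ?exprn_gt0.
apply: (@le_trans _ _ (\sum_(i <oo) \int[mu]_y g i y)%E).
  apply: lee_nneseries => [i _ _|i _]; first exact: integral_ge0.
  apply: le_trans (integral_layer (exprn_gt0 i s0)) _.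
  rewrite levE -/K -ge0_integralZl_EFin//.
  - by move=> y _; rewrite lee_fin.
  - exact/measurable_EFinP.
  - by rewrite mulr_ge0 ?ltW// mulr_gt0 ?exprn_gt0.
rewrite -integral_nneseries//; last first.
  by move=> i; apply/measurable_EFinP; apply: measurable_funM.
rewrite -ge0_integralZl_EFin//; last 3 first.
- by move=> y _; rewrite lee_fin powR_ge0.
- apply/measurable_EFinP; exact: (measurableT_comp (measurable_powR q) mG).
- by rewrite ltW// mulr_gt0.
apply: le_integral_ge0 => y _; first exact: nneseries_ge0.
apply: nneseries_le => // n; rewrite /g sumEFin -EFinM lee_fin.
under eq_bigr do rewrite -(mulrA K).
rewrite -mulr_sumr -(mulrA K) ler_wpM2l ?(ltW K0)//.
have -> : C * G y `^ q = C * G y `^ (q - 1) * G y.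
  have [->|Gy] := eqVneq (G y) 0.
    by rewrite powR0 ?gt_eqF ?(lt_trans _ q1)// !mulr0.
  by rewrite -mulrA -[X in _ = _ * (_ * X)]powRr1// -powRD ?Gy ?implybT// subrK.
apply: (@le_trans _ _ (\sum_(i < n) w * t ^+ i * (w * t ^+ i < G y `^ (q - 1))%R%:R * G y)).
  apply: ler_sum => i _; rewrite !mulrA -mulrA -[X in _ <= X]mulrA.
  rewrite ler_wpM2l ?(ltW (mulr_gt0 w0 (exprn_gt0 i t0)))//.
  rewrite /above /restr mulrC ler_wpM2r// indicE.
  case: (boolP (y \in _)) => // /set_mem /= ylev.
  have -> : (w * t ^+ i < G y `^ (q - 1)) = true; last by [].
  rewrite -levE; apply: lt_powR => //; first by rewrite subr_gt0.
  by apply/ltW/level_gt0; exact: exprn_gt0.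
by rewrite -mulr_suml ler_wpM2r// HC// powR_ge0.
Qed.

Lemma potential_layers C1 C2 : 0 < C1 -> 0 < C2 ->
  (forall (w W : R) n, 0 < w -> 0 <= W ->
    \sum_(i < n) w * ratio 2 ^+ i * (w * ratio 2 ^+ i < W)%R%:R <= C1 * W) ->
  (forall (w W : R) n, 0 < w -> 0 <= W ->
    \sum_(i < n) w * ratio 2^-1 ^+ i * (w * ratio 2^-1 ^+ i < W)%R%:R <= C2 * W) ->
  (\int[mu]_x (potential a G x `^ qb) <=
    (K * C1 + K * C2)%:E * \int[mu]_x (G x `^ q)%:E)%E.
Proof.
move=> C1p C2p H1 H2.
apply: (@le_trans _ _ (\int[mu]_x (\sum_(i <oo) layer (2 ^+ i)%R x +
    \sum_(i <oo) layer (2^-1 ^+ i)%R x))%E).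
  by apply: le_integral_ge0 => x _; [exact: poweR_ge0|exact: potential_le_layers].
have I0 : (0 <= \int[mu]_x (G x `^ q)%:E)%E.
  by apply: integral_ge0 => x _; rewrite lee_fin powR_ge0.
rewrite ge0_integralD//; last 4 first.
- by move=> x _; exact: nneseries_ge0.
- by apply: ge0_emeasurable_sum.
- by move=> x _; exact: nneseries_ge0.
- by apply: ge0_emeasurable_sum.
have E s : (\int[mu]_x \sum_(i <oo) layer (s ^+ i)%R x =
    \sum_(i <oo) \int[mu]_x layer (s ^+ i)%R x)%E.
  by apply: integral_nneseries.
rewrite EFinD ge0_muleDl; last 2 first.
- by rewrite lee_fin mulr_ge0// ltW.
- by rewrite lee_fin mulr_ge0// ltW.
apply: leeD.
- by rewrite E; exact: layers_sum H1 C1p.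
- by rewrite E; exact: layers_sum H2 C2p.
Qed.

End layers.

Theorem potential_strong_type : exists2 C : R, 0 < C & forall G : T -> R,
  measurable_fun setT G -> (forall y, 0 <= G y) ->
  (forall x t, 0 < t -> (mass G x t <= (A * t `^ (D + b))%:E)%E) ->
  (\int[mu]_x (potential a G x `^ (q / (1 + a / b))) <=
    C%:E * \int[mu]_x (G x `^ q)%:E)%E.
Proof.
have h0 : 0 < 2^-1 :> R by [].
have h1 : 2^-1 != 1 :> R by rewrite lt_eqF//; lra.
have t0 : 0 < 2 :> R by [].
have t1 : 2 != 1 :> R by rewrite gt_eqF//; lra.
have [C1 C1p H1] := sum_capped_geometric (ratio_gt0 t0) (ratio_neq1 t0 t1).
have [C2 C2p H2] := sum_capped_geometric (ratio_gt0 h0) (ratio_neq1 h0 h1).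
exists (K * C1 + K * C2); first by rewrite addr_gt0// mulr_gt0.
by move=> G mG G0 massG; exact: potential_layers.
Qed.

End strong_type.

(** * The potential on a ball *)

Lemma poweRD_le (R : realType) (u v : \bar R) (p : R) : (0 <= u)%E -> (0 <= v)%E ->
  0 < p -> ((u + v) `^ p <= (2 `^ p)%:E * (u `^ p + v `^ p))%E.
Proof.
move=> + + p0; have c0 : (0 < (2 `^ p)%:E :> \bar R)%E by rewrite lte_fin powR_gt0.
have pn : p != 0 by rewrite gt_eqF.
case: u => [u| |]//; case: v => [v| |]// u0 v0; last 3 first.
- by rewrite addey// poweRyr// addey ?gt0_muley ?leey//
    gt_eqF// (lt_le_trans _ (poweR_ge0 _ _))// ltNy0.
- by rewrite addye// poweRyr// addye ?gt0_muley ?leey//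
    gt_eqF// (lt_le_trans _ (poweR_ge0 _ _))// ltNy0.
- by rewrite addye// poweRyr// addye// gt0_muley// leey.
rewrite -EFinD !poweR_EFin -EFinD -EFinM lee_fin.
rewrite !lee_fin in u0 v0.
apply: (@le_trans _ _ ((2 * Num.max u v) `^ p)).
  apply: le_powR; rewrite ?addr_ge0 ?(ltW p0)//.
  by rewrite mulrDl !mul1r lerD// le_max lexx ?orbT.
rewrite powRM// ?le_max ?u0// ler_wpM2l ?powR_ge0//.
by have [uv|vu] := leP u v; [rewrite lerDr|rewrite lerDl]; exact: powR_ge0.
Qed.

Section ball_estimate.
Context {disp} {T : measurableType disp} {R : realType}.
Variables (dist : T -> T -> R) (mu : {sigma_finite_measure set T -> \bar R}).
Variables (D c0 c1 : R).
Hypothesis reg : ahlfors_regular dist mu D c0 c1.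

Local Notation ball := (dball dist).
Local Notation mass := (mass dist mu).
Local Notation potential := (potential dist mu D).
Local Notation kernel := (kernel dist D).

Variables (a b q A : R).
Hypotheses (a0 : 0 < a) (aD : a < D) (ab0 : a + b < 0) (q1 : 1 < q) (A0 : 0 < A).

Let q0 : 0 < q. Proof. exact: lt_trans q1. Qed.

Lemma le_mass_radius (F : T -> R) x (s t : R) : (forall y, 0 <= F y) -> s <= t ->
  (mass F x s <= mass F x t)%E.
Proof.
move=> F0 st; apply: le_integral_ge0 => y _; first by rewrite lee_fin mulr_ge0.
rewrite lee_fin ler_wpM2l// !indicE; case: (boolP (y \in ball x s)) => // /set_mem ys.
by rewrite mem_set//; exact: lt_le_trans st.
Qed.

(** Since [dist x y < r] and r is at most half of [dist y z], the triangle inequality leaves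
    [dist x z] at least half of [dist y z]. *)
Lemma kernel_far x y z (r : R) : 0 < r -> ball y r x -> ~ ball y (2 * r) z ->
  kernel a x z <= 2 `^ (D - a) * kernel a y z.
Proof.
rewrite /dball /= => r0 xy /negP; rewrite -leNgt (distC reg z y) => yz.
have := dist_triangle reg y x z; rewrite (distC reg y x) => tri.
have d0 : 0 < dist y z by lra.
apply: le_trans (kernel_le aD (_ : 0 < dist y z / 2) _) _; [lra|lra|].
rewrite -opprB powRN powR_divr ?(ltW d0)// invf_div.
exact: lexx.
Qed.

Let A1 := c1 + A.
Let c10 : 0 < c1. Proof. exact: (c1_gt0 reg). Qed.
Let A10 : 0 < A1. Proof. exact: addr_gt0. Qed.
Let H1 := near_cst D a + A1 * far_cst D a b.
Let H10 : 0 < H1.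
Proof. by rewrite addr_gt0 ?near_cst_gt0// mulr_gt0// far_cst_gt0. Qed.
Let qb := q / (1 + a / b).
Let th0 := exponent_gt0 a0 ab0.
Let qb0 : 0 < qb. Proof. exact: divr_gt0. Qed.

Lemma mass_of_powR (F : T -> R) : measurable_fun setT F -> (forall y, 0 <= F y) ->
  (forall x t, 0 < t -> (mass (fun y => F y `^ q)%R x t <= (A * t `^ (D + b * q))%:E)%E) ->
  forall x t, 0 < t -> (mass F x t <= (A1 * t `^ (D + b))%:E)%E.
Proof.
move=> mF F0 massq x t t0.
have : (mass F x t <= (t `^ b * (c1 + A) * t `^ D)%:E)%E.
  apply: (mass_le_powR reg q1 (powR_gt0 b t0) (ltW A0) t0 mF F0).
  apply: le_trans (massq x t t0) _; rewrite lee_fin -powRrM.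
  rewrite [D + _]addrC powRD ?(gt_eqF t0) ?implybT//.
  by rewrite le_eqVlt; apply/predU1P; left; ring.
move=> /le_trans; apply; rewrite lee_fin powRD ?(gt_eqF t0) ?implybT//.
by rewrite le_eqVlt; apply/predU1P; left; rewrite /A1; ring.
Qed.

Section far_part.
Variables (F : T -> R) (y : T) (r be : R).
Hypotheses (mF : measurable_fun setT F) (F0 : forall z, 0 <= F z).
Hypotheses (r0 : 0 < r) (be0 : 0 < be).
Hypothesis massF : forall x t, 0 < t -> (mass F x t <= (A1 * t `^ (D + b))%:E)%E.
Hypothesis massq : forall k, (mass (fun z => F z `^ q)%R y (2 ^+ k.+1 * r)%R <=
  (be * (2 ^+ k.+1 * r) `^ D)%:E)%E.

Let H := restr F (~` ball y (2 * r)).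
(** Plays the maximal function of [H] at [y]: [be]^
    q^-1[is the height fed to]mass_le_powR[, which returns]c1 + 1[, and]2 [^ D] pays for rounding a
    radius up to a dyadic one. *)
Let m := (c1 + 1) * 2 `^ D * be `^ q^-1.

Let mH : measurable_fun setT H.
Proof.
apply: measurable_restr => //; apply: measurableC.
exact: (measurable_dball reg).
Qed.

Let H0 z : 0 <= H z. Proof. exact: restr_ge0. Qed.

(** For t < r the ball misses the support of [H]. Otherwise t is rounded up to a radius
    [2 ^+ j.+1 * r], at most 2t, where [massq] applies. *)
Let mass_far t : 0 < t -> (mass H y t <= (m * t `^ D)%:E)%E.
Proof.
move=> t0; have [tr|rt] := ltP t r.
  rewrite [X in (X <= _)%E](_ : _ = 0%E).
    by rewrite lee_fin !mulr_ge0 ?powR_ge0// addr_ge0// ltW.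
  apply: integral0_eq => z _; congr _%:E; rewrite /H /restr !indicE in_setC.
  case: (boolP (z \in ball y (2 * r))) => zr; rewrite ?mulr0 ?mul0r//.
  case: (boolP (z \in ball y t)) => zt; rewrite ?mulr0//.
  move/negP : zr => [].
  apply/mem_set; move/set_mem : zt; rewrite /dball/= => /lt_trans; apply; lra.
have r2 : 0 < 2 * r by rewrite mulr_gt0.
have [|j /andP[j1 j2]] := exists_shell_up (r := 2 * r) (t := t) r2.
  by rewrite ler_pM2l.
have rj : 2 ^+ j.+1 * r = 2 * r * 2 ^+ j by rewrite exprS; ring.
have rj0 : 0 < 2 ^+ j.+1 * r by rewrite mulr_gt0 ?exprn_gt0.
apply: (@le_trans _ _ (mass F y (2 ^+ j.+1 * r))).
  apply: (@le_trans _ _ (mass F y t)).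
    by apply: le_mass => // z; exact: restr_le.
  by apply: le_mass_radius => //; rewrite rj ltW.
have bq0 : 0 < be `^ q^-1 by exact: powR_gt0.
apply: le_trans (mass_le_powR reg q1 bq0 ler01 rj0 mF F0 _) _.
  by rewrite -powRrM mulVf ?gt_eqF// powRr1 ?(ltW be0)// mulr1.
have rt2 : (2 ^+ j.+1 * r) `^ D <= 2 `^ D * t `^ D.
  rewrite -powRM ?(ltW t0)//; apply: le_powR; [exact/ltW/(dim_gt0 reg)|exact: ltW|lra].
rewrite lee_fin /m.
have -> : (c1 + 1) * 2 `^ D * be `^ q^-1 * t `^ D =
  be `^ q^-1 * (c1 + 1) * (2 `^ D * t `^ D) by ring.
by rewrite ler_wpM2l// mulr_ge0 ?(ltW bq0)// addr_ge0// ltW.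
Qed.

Lemma potential_far_part x : ball y r x ->
  (potential a H x <= (2 `^ (D - a) * (H1 * m `^ (1 + a / b)))%:E)%E.
Proof.
move=> xr; apply: (@le_trans _ _ ((2 `^ (D - a))%:E * potential a H y)%E).
  rewrite -ge0_integralZl_EFin ?powR_ge0//; last 2 first.
  - by move=> z _; rewrite lee_fin mulr_ge0// kernel_ge0.
  - exact: (measurable_potential_integrand reg).
  apply: le_integral_ge0 => z _; first by rewrite lee_fin mulr_ge0// kernel_ge0.
  rewrite -EFinM lee_fin mulrCA /H /restr indicE in_setC.
  case: (boolP (z \in ball y (2 * r))) => zr; first by rewrite mulr0 !mul0r.
  rewrite mulr1 ler_wpM2l//; apply: (kernel_far r0 xr).
  by move=> H'; move/negP : zr; apply; exact/mem_set.
rewrite EFinM; apply: lee_wpmul2l; first by rewrite lee_fin powR_ge0.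
apply: (hedberg reg a0 aD mH H0 _ (ltW A10) ab0 mass_far).
  by rewrite !mulr_gt0 ?powR_gt0// addr_gt0.
move=> t t0; apply: le_trans (massF y t0); apply: le_mass => z //.
exact: restr_le.
Qed.

End far_part.

(** [be] stands for the supremum over dyadic balls at [y]. The radii start at 2r: k = 0 bounds the
    q-mass of the part of [F] in [ball y (2 * r)], and all k together give the averages for the part
    outside. *)
Theorem ball_potential_le : exists2 C : R, 0 < C & forall F : T -> R,
  measurable_fun setT F -> (forall y, 0 <= F y) ->
  (forall x t, 0 < t ->
    (mass (fun y => F y `^ q)%R x t <= (A * t `^ (D + b * q))%:E)%E) ->
  forall y r be, 0 < r -> 0 <= be ->
  (forall k, (mass (fun z => F z `^ q)%R y (2 ^+ k.+1 * r)%R <=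
    (be * (2 ^+ k.+1 * r) `^ D)%:E)%E) ->
  (\int[mu]_x (potential a F x `^ (q / (1 + a / b)) * (\1_(ball y r) x)%:E) <=
    (C * r `^ D * be)%:E)%E.
Proof.
have [C1 C10 strong] := potential_strong_type reg a0 aD ab0 q1 A10.
pose N := (2 `^ (D - a) * H1) `^ qb * ((c1 + 1) * 2 `^ D) `^ q * c1.
have N0 : 0 < N.
  have ? : 0 < c1 + 1 by exact: addr_gt0.
  by rewrite !mulr_gt0 ?powR_gt0// ?mulr_gt0// ?powR_gt0.
exists (2 `^ qb * (C1 * 2 `^ D + N)).
  by rewrite mulr_gt0 ?powR_gt0// addr_gt0// mulr_gt0// powR_gt0.
move=> F mF F0 massqA y r be r0.
have massF := mass_of_powR mF F0 massqA.
have mB := measurable_dball reg y r.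
have mB2 := measurable_dball reg y (2 * r).
pose G := restr F (ball y (2 * r)); pose H := restr F (~` ball y (2 * r)).
have mG : measurable_fun setT G by exact: measurable_restr.
have G0 z : 0 <= G z by exact: restr_ge0.
have mH : measurable_fun setT H by apply: measurable_restr => //; exact: measurableC.
have H0 z : 0 <= H z by exact: restr_ge0.
have mpot (E : T -> R) : measurable_fun setT E -> (forall z, 0 <= E z) ->
    measurable_fun setT (fun x => potential a E x `^ qb)%E.
  move=> mE E0; apply: (measurableT_comp (measurable_poweR qb)).
  exact: (measurable_potential reg).
(* [hedberg] asks for a positive bound on the averages, so the case [be = 0] is recovered by letting
   e tend to 0. *)
suff main e : 0 < e -> (forall k, (mass (fun z => F z `^ q)%R y (2 ^+ k.+1 * r)%R <=
    (e * (2 ^+ k.+1 * r) `^ D)%:E)%E) ->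
    (\int[mu]_x (potential a F x `^ qb * (\1_(ball y r) x)%:E) <=
      (2 `^ qb * (C1 * 2 `^ D + N) * r `^ D * e)%:E)%E.
  rewrite le_eqVlt => /predU1P[<- massq|]; last exact: main.
  set K := 2 `^ qb * _ * _.
  have K0 : 0 < K.
    by rewrite mulr_gt0 ?powR_gt0// mulr_gt0 ?powR_gt0// addr_gt0// mulr_gt0// powR_gt0.
  rewrite mulr0; apply/lee_addgt0Pr => e e0; rewrite add0e.
  have := main (e / K) (divr_gt0 e0 K0); rewrite -/K.
  have -> : K * (e / K) = e by rewrite mulrC divfK// gt_eqF.
  apply=> k.
  apply: le_trans (massq k) _; rewrite mul0r lee_fin mulr_ge0 ?powR_ge0//.
  by rewrite divr_ge0 ?ltW.
move=> e0 massq.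
pose M := 2 `^ (D - a) * (H1 * ((c1 + 1) * 2 `^ D * e `^ q^-1) `^ (1 + a / b)).
have M0 : 0 <= M by rewrite !mulr_ge0 ?powR_ge0// ltW.
(* The exponents cancel: (1 + a/b) [qb] = q, and e^(1/q) to the power q is e. Thus the far part is
   linear in e, like the q-mass of the near part. *)
have Mqb : M `^ qb * c1 = N * e.
  have ME : M = (2 `^ (D - a) * H1) * ((c1 + 1) * 2 `^ D * e `^ q^-1) `^ (1 + a / b).
    by rewrite /M mulrA.
  have p2 : 0 <= 2 `^ (D - a) * H1 by rewrite mulr_ge0 ?powR_ge0// ltW.
  have p3 : 0 <= (c1 + 1) * 2 `^ D by rewrite mulr_ge0 ?powR_ge0// addr_ge0// ltW.
  have pw X : (X `^ (1 + a / b)) `^ qb = X `^ q :> R.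
    by rewrite -powRrM /qb mulrC divfK// gt_eqF.
  rewrite ME powRM ?powR_ge0// pw.
  rewrite (powRM q p3 (powR_ge0 _ _)) -(powRrM e) mulVf ?gt_eqF//.
  by rewrite powRr1 ?(ltW e0)// /N; ring.
apply: (@le_trans _ _ (\int[mu]_x ((2 `^ qb)%:E *
    (potential a G x `^ qb + (M `^ qb)%:E * (\1_(ball y r) x)%:E)))%E).
  apply: le_integral_ge0 => x _.
    by rewrite mule_ge0 ?poweR_ge0// lee_fin.
  rewrite indicE; case: (boolP (x \in ball y r)) => [/set_mem xr|_]; last first.
    rewrite mule0; rewrite mule_ge0 ?lee_fin ?powR_ge0// adde_ge0 ?poweR_ge0//.
    by rewrite mule0.
  rewrite !mule1 (potential_split reg a x mF mB2 F0).
  apply: le_trans (poweRD_le (potential_ge0 dist mu D a x G0)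
    (potential_ge0 dist mu D a x H0) qb0) _.
  apply: lee_wpmul2l; first by rewrite lee_fin powR_ge0.
  apply: leeD2l; rewrite -poweR_EFin; apply: gt0_ler_poweR; first exact: ltW.
  - by rewrite in_itv/= leey andbT; exact: potential_ge0.
  - by rewrite in_itv/= leey andbT lee_fin.
  exact: (potential_far_part mF F0 r0 e0 massF massq xr).
rewrite ge0_integralZl_EFin ?powR_ge0//; last 2 first.
- by move=> x _; rewrite adde_ge0 ?poweR_ge0// mule_ge0// lee_fin ?powR_ge0.
- apply: emeasurable_funD; first exact: mpot.
  by apply: measurable_funeM; apply/measurable_EFinP; exact: measurable_indic.
rewrite -!mulrA EFinM; apply: lee_wpmul2l; first by rewrite lee_fin powR_ge0.
rewrite ge0_integralD//; last 4 first.
- by move=> x _; exact: poweR_ge0.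
- exact: mpot.
- by move=> x _; rewrite mule_ge0// lee_fin ?powR_ge0.
- by apply: measurable_funeM; apply/measurable_EFinP; exact: measurable_indic.
rewrite mulrDl EFinD; apply: leeD; last first.
  rewrite ge0_integralZl_EFin ?powR_ge0//; last first.
    by apply/measurable_EFinP; exact: measurable_indic.
  rewrite integral_indic// setIT [r `^ D * e]mulrC mulrA -Mqb -mulrA EFinM.
  apply: lee_wpmul2l; first by rewrite lee_fin powR_ge0.
  exact: (ball_le reg).
apply: le_trans (strong G mG G0 _) _.
  move=> x t t0; apply: le_trans (massF x t t0).
  by apply: le_mass => // z; exact: restr_le.
rewrite -mulrA EFinM; apply: lee_wpmul2l; first by rewrite lee_fin ltW.
have -> : (\int[mu]_x (G x `^ q)%:E = mass (fun z => F z `^ q)%R y (2 ^+ 1 * r)%R)%E.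
  apply: eq_integral => x _; rewrite /G /restr expr1 indicE.
  by case: (_ \in _); rewrite ?mulr1// !mulr0 powR0// gt_eqF.
apply: le_trans (massq 0) _; rewrite expr1 powRM ?(ltW r0)// lee_fin.
by rewrite le_eqVlt; apply/predU1P; left; ring.
Qed.

End ball_estimate.

(** * Amalgam norms *)

Section amalgam_bounds.
Context {disp} {T : measurableType disp} {R : realType}.
Variables (dist : T -> T -> R) (mu : {sigma_finite_measure set T -> \bar R}).
Variables (D c0 c1 : R).
Hypothesis reg : ahlfors_regular dist mu D c0 c1.
Implicit Types (F : T -> R).

Local Notation ball := (dball dist).
Local Notation mass := (mass dist mu).
Local Notation potential := (potential dist mu D).

Lemma measurable_mass F t : measurable_fun setT F -> (forall y, 0 <= F y) ->
  measurable_fun setT (fun x => mass F x t).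
Proof.
move=> mF F0.
apply: (@measurable_fun_fubini_tonelli_F _ _ _ _ _ mu
  (fun u : T * T => (F u.2 * \1_(ball u.1 t) u.2)%:E)).
  apply/measurable_EFinP; apply: measurable_funM.
    exact: (measurableT_comp mF measurable_snd).
  exact: (measurable_ball_pair reg).
by move=> u; rewrite lee_fin mulr_ge0.
Qed.

Lemma le_mass_center F y z (r : R) : (forall y, 0 <= F y) -> ball y r z ->
  (mass F y r <= mass F z (2 * r)%R)%E.
Proof.
rewrite /dball /= => F0 zr; apply: le_integral_ge0 => x _.
  by rewrite lee_fin mulr_ge0.
rewrite lee_fin ler_wpM2l// !indicE; case: (boolP (x \in ball y r)) => // /set_mem xr.
rewrite mem_set//; move: xr; rewrite /dball/= => xr.
have := dist_triangle reg x y z; rewrite (distC reg y z); lra.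
Qed.

Section pointwise.
Variables (q : R) (w : R -> R) (F : T -> R).
Hypotheses (q0 : 0 < q) (F0 : forall y, 0 <= F y).

(** By [le_mass_center], the mass at [y] and radius r is at most the mass at radius 2r around every
    point of [ball y r]. Integrating its power p/q over that ball, of measure at least c0 r^D, turns
    a bound in the mean into one at every [y]. *)
Lemma mass_le_of_Lp (p : R) : 0 < p ->
  (forall r, 0 < r -> (\int[mu]_y (mass F y r `^ (p / q)) <= (w r `^ p)%:E)%E) ->
  forall y r, 0 < r ->
    (mass F y r <= (w (2 * r) `^ q * (c0 * r `^ D) `^ (- (q / p)))%:E)%E.
Proof.
move=> p0 wF y r r0; have r20 : 0 < 2 * r by rewrite mulr_gt0.
have pq0 : 0 < p / q by exact: divr_gt0.
have cr0 : 0 < c0 * r `^ D by rewrite mulr_gt0 ?powR_gt0// (c0_gt0 reg).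
have mB := measurable_dball reg y r.
have : ((c0 * r `^ D)%:E * (mass F y r `^ (p / q)) <= (w (2 * r) `^ p)%:E)%E.
  apply: le_trans (wF _ r20).
  apply: (@le_trans _ _ (\int[mu]_x (mass F y r `^ (p / q) * (\1_(ball y r) x)%:E))%E).
    have mind : measurable_fun setT (fun x => (\1_(ball y r) x)%:E : \bar R).
      by apply/measurable_EFinP; exact: measurable_indic.
    rewrite (ge0_integralZl _ measurableT mind)//; last exact: poweR_ge0.
    rewrite integral_indic// setIT muleC; apply: lee_wpmul2l; first exact: poweR_ge0.
    exact: (ball_ge reg).
  apply: le_integral_ge0 => x _; first by rewrite mule_ge0 ?poweR_ge0// lee_fin.
  rewrite indicE; case: (boolP (x \in ball y r)) => [/set_mem xr|_]; last first.
    by rewrite mule0 poweR_ge0.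
  rewrite mule1; apply: gt0_ler_poweR; first exact: ltW.
  - by rewrite in_itv/= leey andbT; exact: mass_ge0.
  - by rewrite in_itv/= leey andbT; exact: mass_ge0.
  exact: le_mass_center.
have := mass_ge0 dist mu y r F0; case: (mass F y r) => [u| |]// u0; last first.
  by rewrite poweRyr ?gt_eqF// gt0_muley.
rewrite poweR_EFin -EFinM !lee_fin => H.
have {}H : u `^ (p / q) <= w (2 * r) `^ p * (c0 * r `^ D)^-1.
  by rewrite ler_pdivlMr// mulrC.
have := @le_powR R _ _ (q / p) (ltW (divr_gt0 q0 p0)) (powR_ge0 _ _) H.
rewrite -powRrM mulrA divfK ?gt_eqF// divff ?gt_eqF// powRr1// => /le_trans; apply.
rewrite powRM ?powR_ge0 ?invr_ge0 ?(ltW cr0)// -powRrM mulrCA divff ?gt_eqF// mulr1.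
by rewrite powRN -[(_ * _)^-1]powR_inv1 ?(ltW cr0)// -powRrM mulN1r powRN.
Qed.

(** If the bound failed at [y], then by [le_mass_center] the bound at radius 2r would fail on all of
    [ball y r], which has positive measure. *)
Lemma mass_le_of_ae :
  (forall r, 0 < r -> {ae mu, forall y, (mass F y r <= (w r `^ q)%:E)%E}) ->
  forall y r, 0 < r -> (mass F y r <= (w (2 * r) `^ q)%:E)%E.
Proof.
move=> wF y r r0; have r20 : 0 < 2 * r by rewrite mulr_gt0.
have [N [mN N0 sub]] := wF _ r20.
apply: contrapT => /negP; rewrite -ltNge => H.
have BN : ball y r `<=` N.
  move=> z yz; apply: sub => /= H'.
  have := le_lt_trans (le_trans (le_mass_center F0 yz) H') H.
  by rewrite ltxx.
have : (mu (ball y r) <= 0)%E.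
  rewrite -N0; apply: le_measure => //; rewrite inE//.
  exact: (measurable_dball reg).
apply/negP; rewrite -ltNge; apply: lt_le_trans (ball_ge reg y r0).
by rewrite lte_fin mulr_gt0 ?powR_gt0// (c0_gt0 reg).
Qed.

End pointwise.
End amalgam_bounds.

(** * Mixed-norm bounds for the potential of a normalised function *)

Section potential_amalgam.
Context {disp} {T : measurableType disp} {R : realType}.
Variables (dist : T -> T -> R) (mu : {sigma_finite_measure set T -> \bar R}).
Variables (D c0 c1 : R).
Hypothesis reg : ahlfors_regular dist mu D c0 c1.
Implicit Types (F : T -> R).

Local Notation ball := (dball dist).
Local Notation mass := (mass dist mu).
Local Notation potential := (potential dist mu D).

Variables (a b q C' : R) (phi : R -> R).
Hypotheses (a0 : 0 < a) (aD : a < D) (ab0 : a + b < 0) (q1 : 1 < q).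
Hypotheses (phi0 : forall r, 0 < r -> 0 < phi r) (C'0 : 0 < C').
Hypothesis phi_le : forall r, 0 < r -> phi r <= C' * r `^ b.

Let q0 : 0 < q. Proof. exact: lt_trans q1. Qed.

(* [ip] stands for [1 / p], so that [p = +oo] is [ip = 0]. *)
Definition amalgam_weight (ip t : R) : R := phi t * t `^ (D * (q^-1 + ip)).
Local Notation w := amalgam_weight.

Lemma amalgam_weight_gt0 ip t : 0 < t -> 0 < w ip t.
Proof. by move=> t0; rewrite mulr_gt0 ?powR_gt0 ?phi0. Qed.

Lemma amalgam_weight_powR ip p t : 0 < t ->
  w ip t `^ p = t `^ (D * (p / q)) * (phi t * t `^ (D * ip)) `^ p.
Proof.
move=> t0; have ph := ltW (phi0 t0).
have tn : (D * q^-1 + D * ip == 0) ==> (t != 0) by rewrite (gt_eqF t0) implybT.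
rewrite /amalgam_weight mulrDr (powRD tn) mulrCA.
rewrite (powRM p (powR_ge0 _ _) (mulr_ge0 ph (powR_ge0 _ _))).
rewrite -powRrM; congr (_ `^ _ * _); ring.
Qed.

Lemma amalgam_weight0_powR t : 0 < t -> w 0 t `^ q = t `^ D * phi t `^ q.
Proof.
move=> t0; rewrite amalgam_weight_powR// divff ?gt_eqF// mulr1 mulr0.
by rewrite powRr0 mulr1.
Qed.

Definition potential_mass F y r : \bar R :=
  (\int[mu]_x (potential a F x `^ (q / (1 + a / b)) * (\1_(ball y r) x)%:E))%E.

Let A ip : R := (C' * 2 `^ (b + D * (q^-1 + ip))) `^ q * c0 `^ (- (q * ip)).

Let A_gt0 ip : 0 < A ip.
Proof. by rewrite mulr_gt0 ?powR_gt0 ?mulr_gt0 ?powR_gt0// (c0_gt0 reg). Qed.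

(** The powers due to [ip] cancel: the weight gives r^(bq + D + D q ip), the other factor r^(-D q
    ip). [A] collects what remains, so it is independent of the function under study. *)
Let weight_le ip r : 0 < r ->
  w ip (2 * r) `^ q * (c0 * r `^ D) `^ (- (q * ip)) <= A ip * r `^ (D + b * q).
Proof.
move=> r0; have r20 : 0 < 2 * r by rewrite mulr_gt0.
have c00 := c0_gt0 reg.
have wle : w ip (2 * r) <= C' * 2 `^ (b + D * (q^-1 + ip)) * r `^ (b + D * (q^-1 + ip)).
  apply: (@le_trans _ _ (C' * (2 * r) `^ b * (2 * r) `^ (D * (q^-1 + ip)))).
    by rewrite /amalgam_weight ler_wpM2r ?powR_ge0// phi_le.
  rewrite -!mulrA -powRM ?(ltW r0)// powRD ?(gt_eqF r20) ?implybT//.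
apply: (@le_trans _ _ ((C' * 2 `^ (b + D * (q^-1 + ip)) *
    r `^ (b + D * (q^-1 + ip))) `^ q * (c0 * r `^ D) `^ (- (q * ip)))).
  apply: ler_wpM2r; first exact: powR_ge0.
  by apply: le_powR; [exact: ltW|exact/ltW/amalgam_weight_gt0|exact: wle].
have X0 : 0 <= C' * 2 `^ (b + D * (q^-1 + ip)) by rewrite mulr_ge0 ?powR_ge0// ltW.
rewrite (powRM q X0 (powR_ge0 _ _)) (powRM _ (ltW c00) (powR_ge0 _ _)) -!(powRrM r).
rewrite mulrACA -powRD; last by rewrite (gt_eqF r0) implybT.
rewrite le_eqVlt; apply/predU1P; left; congr (_ * _ `^ _).
by field; rewrite gt_eqF.
Qed.

Lemma potential_mass_ge0 F y r : (0 <= potential_mass F y r)%E.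
Proof. by apply: integral_ge0 => x _; rewrite mule_ge0 ?poweR_ge0// lee_fin. Qed.

Let qpow F : T -> R := fun y => F y `^ q.
Let measurable_qpow F : measurable_fun setT F -> measurable_fun setT (qpow F).
Proof. by move=> mF; exact: (measurableT_comp (measurable_powR q) mF). Qed.
Let qpow_ge0 F y : 0 <= qpow F y. Proof. exact: powR_ge0. Qed.

Let b0 : b < 0. Proof. by move: a0 ab0; lra. Qed.

Let potential_mass_fin ip C F :
  (forall y r be, 0 < r -> 0 <= be ->
    (forall k, (mass (qpow F) y (2 ^+ k.+1 * r)%R <=
      (be * (2 ^+ k.+1 * r) `^ D)%:E)%E) ->
    (potential_mass F y r <= (C * r `^ D * be)%:E)%E) ->
  (forall y r, 0 < r -> (mass (qpow F) y r <= (A ip * r `^ (D + b * q))%:E)%E) ->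
  forall y r, 0 < r -> (potential_mass F y r < +oo)%E.
Proof.
move=> HC HA y r r0.
have A0 := A_gt0 ip.
apply: (le_lt_trans (HC y r (A ip * r `^ (b * q)) r0 _ _)) (ltry _).
  by rewrite mulr_ge0 ?powR_ge0// ltW.
move=> k; have rk0 : 0 < 2 ^+ k.+1 * r by rewrite mulr_gt0 ?exprn_gt0.
apply: le_trans (HA y _ rk0) _; rewrite lee_fin addrC.
rewrite powRD ?(gt_eqF rk0) ?implybT// mulrA ler_wpM2r ?powR_ge0//.
rewrite ler_wpM2l ?(ltW A0)//; apply: ge_powR => //.
  by rewrite nmulr_rle0// ltW.
by rewrite ler_pMl// exprn_ege1// ler1n.
Qed.

Theorem potential_amalgam_Lp (p Cs : R) : 0 < p -> 0 < Cs ->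
  (forall r n, 0 < r -> \sum_(k < n) (phi (2 ^+ k.+1 * r) *
      (2 ^+ k.+1 * r) `^ (D / p)) `^ p <= Cs * (phi r * r `^ (D / p)) `^ p) ->
  exists2 K : R, 0 < K & forall F, measurable_fun setT F -> (forall y, 0 <= F y) ->
  (forall r, 0 < r -> (\int[mu]_y (mass (fun z => F z `^ q)%R y r `^ (p / q)) <=
    (w p^-1 r `^ p)%:E)%E) ->
  (forall y r, 0 < r -> (potential_mass F y r < +oo)%E) /\
  (forall r, 0 < r -> (\int[mu]_y (potential_mass F y r `^ (p / q)) <=
    (K * w p^-1 r `^ p)%:E)%E).
Proof.
move=> p0 Cs0 Hsum.
have [C C0 HC] := ball_potential_le reg a0 aD ab0 q1 (A_gt0 p^-1).
have pq0 : 0 < p / q by exact: divr_gt0.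
exists (C `^ (p / q) * Cs); first by rewrite mulr_gt0 ?powR_gt0.
move=> F mF F0 wF.
have HA y r : 0 < r -> (mass (qpow F) y r <= (A p^-1 * r `^ (D + b * q))%:E)%E.
  move=> r0; have H := mass_le_of_Lp reg q0 (qpow_ge0 F) p0 wF y r0.
  by apply: (le_trans H); rewrite lee_fin; exact: weight_le.
have {}HC := HC F mF F0 HA.
split; first exact: (potential_mass_fin HC HA).
move=> r r0; pose rad k := 2 ^+ k.+1 * r.
have rad0 k : 0 < rad k by rewrite mulr_gt0 ?exprn_gt0.
(* The power p/q of the mass divided by ([rad k])^D. If s is the sum over k, each term is at most s,
   so s^(q/p) is an admissible [be]. *)
pose term k y := ((rad k `^ (- (D * (p / q))))%:E * (mass (qpow F) y (rad k) `^ (p / q)))%E.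
have term0 k y : (0 <= term k y)%E.
  by rewrite mule_ge0 ?poweR_ge0// lee_fin powR_ge0.
have mterm k : measurable_fun setT (term k).
  apply: measurable_funeM; apply: (measurableT_comp (measurable_poweR _)).
  by apply: (measurable_mass reg) => //; exact: measurable_qpow.
pose c := (C * r `^ D) `^ (p / q).
have c_gt0 : 0 < c by rewrite powR_gt0// mulr_gt0 ?powR_gt0.
apply: (@le_trans _ _ (\int[mu]_y (c%:E * \sum_(k <oo) term k y))%E).
  apply: le_integral_ge0 => y _; first exact: poweR_ge0.
  have : (0 <= \sum_(k <oo) term k y)%E by exact: nneseries_ge0.
  case sE : (\sum_(k <oo) term k y)%E => [s| |]// s0; last first.
    by rewrite gt0_muley ?lte_fin// leey.
  rewrite lee_fin in s0.
  have Hbe : (potential_mass F y r <= (C * r `^ D * s `^ (q / p))%:E)%E.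
    apply: HC => //; first exact: powR_ge0.
    move=> k; rewrite -/(rad k).
    have := le_nneseries_term (u := fun k => term k y) k (fun i => term0 i y).
    rewrite sE /term.
    have := HA y _ (rad0 k); have := mass_ge0 dist mu y (rad k) (qpow_ge0 F).
    rewrite -/(qpow F); case: (mass (qpow F) y (rad k)) => [u| |]//.
    rewrite lee_fin => u0 _; rewrite poweR_EFin -EFinM !lee_fin => H.
    have {}H : u `^ (p / q) <= s * rad k `^ (D * (p / q)).
      rewrite -ler_pdivrMr ?powR_gt0//.
      by rewrite mulrC -powRN.
    have := @le_powR R _ _ (q / p) (ltW (divr_gt0 q0 p0)) (powR_ge0 _ _) H.
    rewrite -powRrM mulrA divfK ?gt_eqF// divff ?gt_eqF// powRr1// => /le_trans; apply.
    rewrite powRM ?powR_ge0// ler_wpM2l ?powR_ge0// -powRrM.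
    by rewrite -mulrA [p / q * _]mulrA divfK ?gt_eqF// divff ?gt_eqF// mulr1.
  apply: le_trans (gt0_ler_poweR (ltW pq0) _ _ Hbe) _.
  - by rewrite in_itv/= leey andbT potential_mass_ge0.
  - by rewrite in_itv/= leey andbT lee_fin !mulr_ge0 ?powR_ge0// ltW.
  rewrite poweR_EFin powRM ?powR_ge0 ?mulr_ge0 ?powR_ge0 ?(ltW C0)//.
  by rewrite -powRrM mulrA divfK ?gt_eqF// divff ?gt_eqF// powRr1// EFinM.
rewrite ge0_integralZl_EFin ?(ltW c_gt0)//; last 2 first.
- by move=> y _; exact: nneseries_ge0.
- by apply: ge0_emeasurable_sum.
have -> : (\int[mu]_y \sum_(k <oo) term k y = \sum_(k <oo) \int[mu]_y term k y)%E.
  by apply: integral_nneseries.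
have -> : C `^ (p / q) * Cs * w p^-1 r `^ p = c * (Cs * (phi r * r `^ (D / p)) `^ p).
  rewrite amalgam_weight_powR// /c (powRM _ (ltW C0) (powR_ge0 _ _)) -powRrM; ring.
rewrite EFinM; apply: lee_wpmul2l; first by rewrite lee_fin ltW.
apply: nneseries_le => [k|n]; first exact: integral_ge0.
(* The weight to the power p contains the factor ([rad k])^(D p/q), which the normalisation of
   [term] removes; what is left is the summand of [Hsum]. *)
apply: (@le_trans _ _ (\sum_(k < n) ((phi (rad k) * rad k `^ (D / p)) `^ p)%:E)%E).
  apply: lee_sum => k _.
  rewrite /term ge0_integralZl_EFin ?powR_ge0//; last 2 first.
  - by move=> y _; exact: poweR_ge0.
  - apply: (measurableT_comp (measurable_poweR _)).
    by apply: (measurable_mass reg) => //; exact: measurable_qpow.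
  apply: (@le_trans _ _ ((rad k `^ (- (D * (p / q))))%:E * (w p^-1 (rad k) `^ p)%:E)%E).
    by apply: lee_wpmul2l; [rewrite lee_fin powR_ge0|exact: wF].
  rewrite -EFinM lee_fin; move: (rad k) (rad0 k) => t t0.
  rewrite le_eqVlt; apply/predU1P; left.
  transitivity (t `^ (- (D * (p / q))) *
      (t `^ (D * (p / q)) * (phi t * t `^ (D / p)) `^ p)).
    by congr (_ * _); exact: amalgam_weight_powR.
  by rewrite powRN mulKf// gt_eqF// powR_gt0.
by rewrite sumEFin lee_fin; exact: Hsum.
Qed.

Theorem potential_amalgam_Loo (Cd : R) : 0 < Cd ->
  (forall r s, 0 < r -> r <= s -> phi s <= Cd * phi r) ->
  exists2 K : R, 0 < K & forall F, measurable_fun setT F -> (forall y, 0 <= F y) ->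
  (forall r, 0 < r ->
    {ae mu, forall y, (mass (fun z => F z `^ q)%R y r <= (w 0 r `^ q)%:E)%E}) ->
  (forall y r, 0 < r -> (potential_mass F y r < +oo)%E) /\
  (forall r, 0 < r ->
    {ae mu, forall y, (potential_mass F y r <= (K * w 0 r `^ q)%:E)%E}).
Proof.
move=> Cd0 dec.
have [C C0 HC] := ball_potential_le reg a0 aD ab0 q1 (A_gt0 0).
exists (C * Cd `^ q); first by rewrite mulr_gt0 ?powR_gt0.
move=> F mF F0 wF.
have HA y r : 0 < r -> (mass (qpow F) y r <= (A 0 * r `^ (D + b * q))%:E)%E.
  move=> r0.
  have H := mass_le_of_ae reg (qpow_ge0 F) wF y r0.
  apply: (le_trans H); rewrite lee_fin.
  by have := weight_le 0 r0; rewrite mulr0 oppr0 powRr0 mulr1.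
have {}HC := HC F mF F0 HA.
split; first exact: (potential_mass_fin HC HA).
move=> r r0; pose rad k := 2 ^+ k.+1 * r.
have rad0 k : 0 < rad k by rewrite mulr_gt0 ?exprn_gt0.
have : {ae mu, forall y, forall k, (mass (qpow F) y (rad k) <= (w 0 (rad k) `^ q)%:E)%E}.
  by apply: ae_foralln => k; exact: wF.
apply: filterS => y Hy.
have -> : C * Cd `^ q * w 0 r `^ q = C * r `^ D * (Cd * phi r) `^ q.
  by rewrite amalgam_weight0_powR// (powRM _ (ltW Cd0) (ltW (phi0 r0))); ring.
apply: HC => //; first exact: powR_ge0.
move=> k; apply: le_trans (Hy k) _; rewrite lee_fin -/(rad k).
have ph := ltW (phi0 (rad0 k)).
rewrite amalgam_weight0_powR// mulrC ler_wpM2r ?powR_ge0//.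
apply: le_powR => //; first exact: ltW.
by apply: dec => //; rewrite ler_pMl// exprn_ege1// ler1n.
Qed.

End potential_amalgam.

(** * Amalgam norms in terms of ball masses, and their homogeneity *)

Section amalgam_norms.
Context {disp} {T : measurableType disp} {R : realType}.
Variables (dist : T -> T -> R) (mu : {sigma_finite_measure set T -> \bar R}).
Variables (D c0 c1 : R).
Hypothesis reg : ahlfors_regular dist mu D c0 c1.
Implicit Types (F : T -> R).

Local Notation ball := (dball dist).
Local Notation mass := (mass dist mu).
Local Notation potential := (potential dist mu D).

Definition amalgam (q p : \bar R) (r : R) (F : T -> R) : \bar R :=
  Lnorm mu p (fun y => Lnorm mu q (fun x => (F x * \1_(ball y r) x)%:E)).

Lemma powR_indic (x q : R) (E : set T) y : q != 0 ->
  (x * \1_E y) `^ q = x `^ q * \1_E y.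
Proof. by move=> q0; rewrite indicE; case: (_ \in _); rewrite ?mulr1// !mulr0 powR0. Qed.

Lemma Lnorm_ball F (q : R) y r : 0 < q -> (forall x, 0 <= F x) ->
  Lnorm mu q%:E (fun x => (F x * \1_(ball y r) x)%:E) =
    (mass (fun x => F x `^ q)%R y r `^ q^-1)%E.
Proof.
move=> q0 F0; rewrite unlock; congr (_ `^ _)%E; apply: eq_integral => x _.
by rewrite gee0_abs ?lee_fin ?mulr_ge0// poweR_EFin powR_indic// gt_eqF.
Qed.

Lemma Lnorm_powR_le (u : T -> \bar R) (g : T -> \bar R) (p q : R) :
  0 < p -> (forall y, 0 <= u y)%E -> (forall y, u y <= g y `^ q^-1)%E ->
  (Lnorm mu p%:E u <= (\int[mu]_y (g y `^ (p / q))) `^ p^-1)%E.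
Proof.
move=> p0 u0 ug; rewrite unlock; apply: gt0_ler_poweR.
- by rewrite invr_ge0 ltW.
- rewrite in_itv/= leey andbT; apply: integral_ge0 => y _; exact: poweR_ge0.
- rewrite in_itv/= leey andbT; apply: integral_ge0 => y _; exact: poweR_ge0.
apply: le_integral_ge0 => y _; first exact: poweR_ge0.
rewrite gee0_abs// [p / q]mulrC poweRrM; apply: gt0_ler_poweR; first exact: ltW.
- by rewrite in_itv/= leey andbT.
- by rewrite in_itv/= leey andbT poweR_ge0.
exact: ug.
Qed.

Lemma Lnormy (u : T -> \bar R) : (0 < mu setT)%E ->
  Lnorm mu +oo%E u = ess_sup mu (abse \o u).
Proof. by move=> muT; rewrite unlock muT. Qed.

Section scaling.
Variables (a b q M : R).
Hypotheses (a0 : 0 < a) (aD : a < D) (ab0 : a + b < 0) (q1 : 1 < q) (M0 : 0 < M).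

Let th := 1 + a / b.
Let th0 : 0 < th. Proof. exact: exponent_gt0. Qed.
Let q0 : 0 < q. Proof. exact: lt_trans q1. Qed.

Variable F : T -> R.
Hypotheses (mF : measurable_fun setT F) (F0 : forall x, 0 <= F x).

Let G x := F x / M.
Let mG : measurable_fun setT G. Proof. exact: measurable_funM. Qed.
Let G0 x : 0 <= G x. Proof. by rewrite divr_ge0// ltW. Qed.

Lemma mass_scale y r :
  mass (fun x => G x `^ q)%R y r = ((M `^ (- q))%:E * mass (fun x => F x `^ q)%R y r)%E.
Proof.
rewrite /mass -ge0_integralZl_EFin ?powR_ge0//; last 2 first.
- by move=> x _; rewrite lee_fin mulr_ge0 ?powR_ge0.
- apply: (measurable_mass_integrand reg).
  exact: (measurableT_comp (measurable_powR q) mF).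
apply: eq_integral => x _; rewrite -EFinM mulrA; congr (_ * _)%:E.
by rewrite /G powR_divr ?(ltW M0)// powRN mulrC.
Qed.

Lemma potential_scale x : potential a F x = (M%:E * potential a G x)%E.
Proof.
rewrite /potential -ge0_integralZl_EFin ?(ltW M0)//; last 2 first.
- by move=> y _; rewrite lee_fin mulr_ge0// kernel_ge0.
- exact: (measurable_potential_integrand reg).
apply: eq_integral => y _; rewrite -EFinM mulrA; congr (_ * _)%:E.
by rewrite /G mulrC divfK// gt_eqF.
Qed.

Lemma amalgam_Lp_scale (p r W : R) : 0 < p -> 0 < W ->
  (amalgam q%:E p%:E r F <= (M * W)%:E)%E ->
  (\int[mu]_y (mass (fun x => G x `^ q)%R y r `^ (p / q)) <= (W `^ p)%:E)%E.
Proof.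
move=> p0 W0 FW.
have U0 y : (0 <= mass (fun x => F x `^ q)%R y r)%E.
  by apply: mass_ge0 => x; exact: powR_ge0.
have Ip : (\int[mu]_y (mass (fun x => F x `^ q)%R y r `^ (p / q)) <=
    ((M * W) `^ p)%:E)%E.
  have E : (amalgam q%:E p%:E r F `^ p =
      \int[mu]_y (mass (fun x => F x `^ q)%R y r `^ (p / q)))%E.
    rewrite /amalgam poweR_Lnorm ?gt_eqF//; apply: eq_integral => y _.
    by rewrite Lnorm_ball// gee0_abs ?poweR_ge0// -poweRrM mulrC.
  rewrite -E -poweR_EFin; apply: gt0_ler_poweR => //; first exact: ltW.
  - by rewrite in_itv/= leey andbT; exact: Lnorm_ge0.
  - by rewrite in_itv/= leey andbT lee_fin mulr_ge0// ltW.
have -> : (\int[mu]_y (mass (fun x => G x `^ q)%R y r `^ (p / q)) =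
    (M `^ (- p))%:E * \int[mu]_y (mass (fun x => F x `^ q)%R y r `^ (p / q)))%E.
  rewrite -ge0_integralZl_EFin ?powR_ge0//; last 2 first.
  - by move=> y _; exact: poweR_ge0.
  - apply: (measurableT_comp (measurable_poweR _)).
    apply: (measurable_mass reg) => [|y]; last exact: powR_ge0.
    exact: (measurableT_comp (measurable_powR q) mF).
  apply: eq_integral => y _; rewrite mass_scale poweRM ?lee_fin ?powR_ge0//.
  rewrite poweR_EFin -powRrM mulNr mulrCA divff ?gt_eqF// mulr1//.
apply: (@le_trans _ _ ((M `^ (- p))%:E * ((M * W) `^ p)%:E)%E).
  by apply: lee_wpmul2l; first by rewrite lee_fin powR_ge0.
rewrite -EFinM lee_fin powRM ?(ltW M0) ?(ltW W0)// powRN mulKf//.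
by rewrite gt_eqF// powR_gt0.
Qed.

Lemma amalgam_Loo_scale (r W : R) : 0 < W -> (0 < mu setT)%E ->
  (amalgam q%:E +oo%E r F <= (M * W)%:E)%E ->
  {ae mu, forall y, (mass (fun x => G x `^ q)%R y r <= (W `^ q)%:E)%E}.
Proof.
move=> W0 muT; rewrite /amalgam.
have -> : (fun y => Lnorm mu q%:E (fun x => (F x * \1_(ball y r) x)%:E)) =
    (fun y => mass (fun x => F x `^ q)%R y r `^ q^-1)%E.
  by apply/funext => y; exact: Lnorm_ball.
rewrite Lnormy// => /ess_supP; apply: filterS => y /=.
rewrite gee0_abs ?poweR_ge0// => H.
have U0 : (0 <= mass (fun x => F x `^ q)%R y r)%E.
  by apply: mass_ge0 => x; exact: powR_ge0.
have {}H : (mass (fun x => F x `^ q)%R y r <= ((M * W) `^ q)%:E)%E.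
  have := gt0_ler_poweR (ltW q0) _ _ H.
  rewrite -poweRrM mulVf ?gt_eqF// poweRe1// poweR_EFin; apply.
  - by rewrite in_itv/= leey andbT poweR_ge0.
  - by rewrite in_itv/= leey andbT lee_fin mulr_ge0// ltW.
rewrite mass_scale; apply: (@le_trans _ _ ((M `^ (- q))%:E * ((M * W) `^ q)%:E)%E).
  by apply: lee_wpmul2l; first by rewrite lee_fin powR_ge0.
rewrite -EFinM lee_fin powRM ?(ltW M0) ?(ltW W0)// powRN mulKf//.
by rewrite gt_eqF// powR_gt0.
Qed.

Local Notation V := (potential_mass dist mu D a b q).

Let measurable_pot : measurable_fun setT (fun x => potential a G x `^ (q / th))%E.
Proof.
by apply: (measurableT_comp (measurable_poweR _)); exact: (measurable_potential reg).
Qed.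

Lemma measurable_potential_mass r : measurable_fun setT (fun y => V G y r).
Proof.
apply: (@measurable_fun_fubini_tonelli_F _ _ _ _ _ mu
  (fun u : T * T => potential a G u.2 `^ (q / th) * (\1_(ball u.1 r) u.2)%:E)%E).
  apply: emeasurable_funM; first exact: (measurableT_comp measurable_pot measurable_snd).
  by apply/measurable_EFinP; exact: (measurable_ball_pair reg).
by move=> u; rewrite mule_ge0 ?poweR_ge0// lee_fin.
Qed.

Variables (F' : T -> R) (c : R).
Hypotheses (c_gt0 : 0 < c) (F'0 : forall x, 0 <= F' x).
Hypothesis F'_le : forall x, ((F' x)%:E <= c%:E * potential a F x)%E.

Let cM0 : 0 < c * M. Proof. exact: mulr_gt0. Qed.

Let F'_leG x : ((F' x)%:E <= (c * M)%:E * potential a G x)%E.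
Proof. by rewrite EFinM -muleA -potential_scale. Qed.

Lemma Lnorm_ball_le_potential y r :
  (Lnorm mu (q / th)%:E (fun x => (F' x * \1_(ball y r) x)%:E) <=
    (c * M)%:E * V G y r `^ (q / th)^-1)%E.
Proof.
have qt0 : 0 < q / th by exact: divr_gt0.
have qtV : 0 <= (q / th)^-1 by rewrite invr_ge0 ltW.
rewrite Lnorm_ball//.
have -> : ((c * M)%:E * V G y r `^ (q / th)^-1 =
    (((c * M) `^ (q / th))%:E * V G y r) `^ (q / th)^-1)%E.
  rewrite poweRM ?lee_fin ?powR_ge0 ?potential_mass_ge0// poweR_EFin.
  by rewrite powRK ?gt_eqF// ltW.
apply: gt0_ler_poweR => //.
- by rewrite in_itv/= leey andbT; apply: mass_ge0 => x; exact: powR_ge0.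
- by rewrite in_itv/= leey andbT mule_ge0 ?lee_fin ?powR_ge0 ?potential_mass_ge0.
rewrite /potential_mass -ge0_integralZl_EFin ?powR_ge0//; last 2 first.
- by move=> x _; rewrite mule_ge0 ?poweR_ge0// lee_fin.
- apply: emeasurable_funM => //.
  by apply/measurable_EFinP; apply: measurable_indic; exact: (measurable_dball reg).
apply: le_integral_ge0 => x _; first by rewrite lee_fin mulr_ge0 ?powR_ge0.
rewrite EFinM muleA; apply: lee_wpmul2r; first by rewrite lee_fin.
rewrite -!poweR_EFin -poweRM ?lee_fin ?(ltW cM0)//; last exact: potential_ge0.
apply: gt0_ler_poweR; first exact: ltW.
- by rewrite in_itv/= leey andbT lee_fin.
- rewrite in_itv/= leey andbT mule_ge0 ?lee_fin ?(ltW cM0)//; exact: potential_ge0.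
exact: F'_leG.
Qed.

(** Both exponents are divided by [th], so their ratio is still p/q and the bound on the potential
    mass applies as it stands. The final root of order p/[th] turns K^p into K^[th]. *)
Lemma amalgam_potential_Lp (p r K : R) : 0 < p -> 0 <= K ->
  (\int[mu]_y (V G y r `^ (p / q)) <= (K `^ p)%:E)%E ->
  (amalgam (q / th)%:E (p / th)%:E r F' <= (c * M * K `^ th)%:E)%E.
Proof.
move=> p0 K0 VK.
have qt0 : 0 < q / th by exact: divr_gt0.
have pt0 : 0 < p / th by exact: divr_gt0.
apply: le_trans (Lnorm_powR_le
  (g := fun y => (((c * M) `^ (q / th))%:E * V G y r)%E) (q := q / th) pt0 _ _) _.
- by move=> y; exact: Lnorm_ge0.
- move=> y; apply: le_trans (Lnorm_ball_le_potential y r) _.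
  rewrite poweRM ?lee_fin ?powR_ge0 ?potential_mass_ge0// poweR_EFin.
  by rewrite powRK ?gt_eqF// ltW.
have -> : p / th / (q / th) = p / q by field; rewrite !gt_eqF.
have -> : (\int[mu]_y ((((c * M) `^ (q / th))%:E * V G y r) `^ (p / q)) =
    ((c * M) `^ (p / th))%:E * \int[mu]_y (V G y r `^ (p / q)))%E.
  rewrite -ge0_integralZl_EFin ?powR_ge0//; last 2 first.
  - by move=> y _; exact: poweR_ge0.
  - apply: (measurableT_comp (measurable_poweR _)); exact: measurable_potential_mass.
  apply: eq_integral => y _.
  rewrite poweRM ?lee_fin ?powR_ge0 ?potential_mass_ge0// poweR_EFin -powRrM.
  by congr ((_ `^ _)%:E * _)%E; field; rewrite !gt_eqF.
apply: (@le_trans _ _ ((((c * M) `^ (p / th))%:E * (K `^ p)%:E) `^ (p / th)^-1)%E).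
  apply: gt0_ler_poweR; first by rewrite invr_ge0 ltW.
  - rewrite in_itv/= leey andbT mule_ge0 ?lee_fin ?powR_ge0//.
    by apply: integral_ge0 => y _; exact: poweR_ge0.
  - by rewrite in_itv/= leey andbT mule_ge0 ?lee_fin ?powR_ge0.
  by apply: lee_wpmul2l; first by rewrite lee_fin powR_ge0.
rewrite -EFinM poweR_EFin lee_fin (powRM _ (powR_ge0 _ _) (powR_ge0 _ _)).
rewrite powRK ?gt_eqF// ?(ltW cM0)//.
rewrite -powRrM le_eqVlt; apply/predU1P; left; congr (_ * _ `^ _).
by field; rewrite !gt_eqF.
Qed.

Lemma amalgam_potential_Loo (r K : R) : 0 <= K -> (0 < mu setT)%E ->
  {ae mu, forall y, (V G y r <= (K `^ q)%:E)%E} ->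
  (amalgam (q / th)%:E +oo%E r F' <= (c * M * K `^ th)%:E)%E.
Proof.
move=> K0 muT VK.
have qt0 : 0 < q / th by exact: divr_gt0.
rewrite /amalgam Lnormy//; apply/ess_supP.
apply: filterS VK => y VK /=.
rewrite gee0_abs ?Lnorm_ge0//; apply: le_trans (Lnorm_ball_le_potential y r) _.
rewrite (EFinM (c * M)); apply: lee_wpmul2l; first by rewrite lee_fin ltW.
have -> : (K `^ th)%:E = ((K `^ q)%:E `^ (q / th)^-1)%E.
  by rewrite poweR_EFin -powRrM invf_div mulrC divfK// gt_eqF.
apply: gt0_ler_poweR => //; first by rewrite invr_ge0 ltW.
- by rewrite in_itv/= leey andbT; exact: potential_mass_ge0.
- by rewrite in_itv/= leey andbT lee_fin powR_ge0.
Qed.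

(** A power of the potential is integrable on each of the balls of integer radius around [y0], which
    exhaust the space; countably many null sets are discarded. *)
Lemma potential_fin_ae (y0 : T) : (forall y r, 0 < r -> (V G y r < +oo)%E) ->
  {ae mu, forall x, (potential a F x < +oo)%E}.
Proof.
move=> Vfin.
have qt0 : 0 < q / th by exact: divr_gt0.
have : {ae mu, forall x, forall n, potential a G x `^ (q / th) *
    (\1_(ball y0 n.+1%:R) x)%:E \is a fin_num}%E.
  apply: ae_foralln => n.
  have : mu.-integrable setT (fun x => potential a G x `^ (q / th) *
      (\1_(ball y0 n.+1%:R) x)%:E)%E.
    apply/integrableP; split.
      apply: emeasurable_funM => //.
      by apply/measurable_EFinP; apply: measurable_indic; exact: (measurable_dball reg).
    under eq_integral do rewrite gee0_abs ?mule_ge0 ?poweR_ge0 ?lee_fin//.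
    exact: Vfin.
  by move=> /(integrable_ae measurableT); apply: filterS => x /(_ I).
apply: filterS => x Hx; rewrite potential_scale.
have [n xn] : exists n : nat, dist x y0 < n.+1%:R.
  exists (Num.truncn `|dist x y0|); apply: le_lt_trans (ler_norm _) _; exact: truncnS_gt.
have := Hx n; rewrite indicE mem_set// mule1.
have := potential_ge0 dist mu D a x G0.
case: (potential a G x) => [u| |]// u0; first by rewrite -EFinM ltry.
by rewrite poweRyr ?gt_eqF.
Qed.

End scaling.
End amalgam_norms.

(** * The growth condition on phi *)

Section dyadic_sum.
Context {R : realType}.
Variables (phi : R -> R) (e q p C C1 : R).
Hypotheses (q0 : 0 < q) (qp : q <= p) (C10 : 0 < C1).
Hypothesis phi0 : forall t, 0 < t -> 0 < phi t.
Hypothesis dec : forall r s, 0 < r -> r <= s ->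
  phi s * s `^ e <= C1 * (phi r * r `^ e).
Hypothesis phi_int : forall r, 0 < r ->
  (\int[@lebesgue_measure R]_(t in `]r, +oo[) (phi t `^ q * t `^ (e * q - 1))%:E
    <= (C * (phi r `^ q * r `^ (e * q)))%:E)%E.

Let h t := phi t * t `^ e.
Let h0 t : 0 < t -> 0 < h t.
Proof. by move=> t0; rewrite mulr_gt0 ?powR_gt0 ?phi0. Qed.

Let hq t : 0 < t -> h t `^ q = phi t `^ q * t `^ (e * q).
Proof. by move=> t0; rewrite (powRM q (ltW (phi0 t0)) (powR_ge0 _ _)) -powRrM. Qed.

(** The integrand is h(t)^q / t. On each dyadic interval it is bounded below by a constant, through
    almost monotonicity at the right endpoint; the resulting step function can be integrated
    whatever [phi] is. *)
Lemma dyadic_sum_q r n : 0 < r ->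
  \sum_(k < n) h (2 ^+ k.+1 * r) `^ q <= 2 * C1 `^ q * C * h r `^ q.
Proof.
move=> r0; pose rad k : R := 2 ^+ k * r.
have rad0 k : 0 < rad k by rewrite mulr_gt0 ?exprn_gt0.
have radS k : rad k.+1 = 2 * rad k by rewrite /rad exprS mulrA.
have rad_le j k : (j <= k)%N -> rad j <= rad k.
  by move=> jk; rewrite ler_pM2r// ler_weXn2l// ler1n.
pose I k : set R := `]rad k, rad k.+1]%classic.
pose c k := (h (rad k.+1) / C1) `^ q / rad k.+1.
have c0 k : 0 <= c k by rewrite divr_ge0 ?powR_ge0// ltW.
have mI k : measurable (I k) by exact: measurable_itv.
have below t : `]r, +oo[%classic t ->
    \sum_(k < n) c k * \1_(I k) t <= phi t `^ q * t `^ (e * q - 1).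
  rewrite /= in_itv/= andbT => rt; have t0 : 0 < t by exact: lt_trans rt.
  have rhs0 : 0 <= phi t `^ q * t `^ (e * q - 1) by rewrite mulr_ge0 ?powR_ge0.
  have [[j tj]|nj] := pselect (exists j : 'I_n, I j t); last first.
    rewrite big1// => k _; rewrite indicE memNset ?mulr0// => tk.
    by apply: nj; exists k.
  rewrite (bigD1 j)//= big1 ?addr0; last first.
    move=> k kj; rewrite indicE memNset ?mulr0//.
    move: tj; rewrite /I /= !in_itv/= => /andP[j1 j2] /andP[k1 k2].
    have [jk|jk|jk] := ltngtP j k.
    - by have := le_lt_trans (le_trans j2 (rad_le _ _ jk)) k1; rewrite ltxx.
    - by have := le_lt_trans (le_trans k2 (rad_le _ _ jk)) j1; rewrite ltxx.
    - by move/eqP : kj; apply; apply: val_inj.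
  rewrite indicE mem_set// mulr1.
  move: tj; rewrite /I /= in_itv/= => /andP[j1 j2].
  have -> : phi t `^ q * t `^ (e * q - 1) = h t `^ q / t.
    rewrite hq// powRD ?(gt_eqF t0) ?implybT// powRN powRr1 ?(ltW t0)//.
    by rewrite mulrA.
  apply: (@le_trans _ _ (h t `^ q / rad j.+1)).
    rewrite ler_wpM2r// ?invr_ge0 ?(ltW (rad0 _))//; apply: le_powR.
    - exact: ltW.
    - by rewrite divr_ge0 ?ltW ?h0.
    - by rewrite ler_pdivrMr// mulrC; exact: dec.
  rewrite ler_wpM2l ?powR_ge0//.
  by rewrite lef_pV2 ?posrE.
have int_le : ((\sum_(k < n) (c k * rad k))%:E <= (C * h r `^ q)%:E)%E.
  rewrite hq//; apply: le_trans (phi_int r0).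
  apply: (@le_trans _ _ (\int[@lebesgue_measure R]_(t in `]r, +oo[)
      \sum_(k < n) (c k * \1_(I k) t)%:E)%E).
    rewrite ge0_integral_sum//; last 2 first.
    - move=> k; apply/measurable_EFinP; apply: measurable_funM => //.
      by apply: measurable_indic; exact: mI.
    - by move=> k t _; rewrite lee_fin mulr_ge0.
    rewrite -sumEFin; apply: lee_sum => k _.
    under eq_integral do rewrite EFinM.
    rewrite ge0_integralZl_EFin//; last first.
      by apply/measurable_EFinP; apply: measurable_indic; exact: mI.
    rewrite integral_indic//; last exact: mI.
    rewrite EFinM; apply: lee_wpmul2l; first by rewrite lee_fin.
    rewrite (_ : I k `&` _ = I k); last first.
      apply/setIidPl => t; rewrite /I /= !in_itv/= andbT => /andP[k1 _].
      apply: le_lt_trans k1; have := rad_le 0 k (leq0n _).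
      by rewrite /rad expr0 mul1r.
    have Ik : lebesgue_measure (I k) = (rad k)%:E.
      rewrite /I lebesgue_measure_itv/= lte_fin radS ifT; last by move: (rad0 k); lra.
      by rewrite -EFinB; congr _%:E; lra.
    by rewrite -[X in (X <= _)%E]Ik.
  apply: le_integral_ge0 => t tr.
    by apply: sume_ge0 => k _; rewrite lee_fin mulr_ge0.
  by rewrite sumEFin lee_fin; exact: below.
have -> : \sum_(k < n) h (2 ^+ k.+1 * r) `^ q =
    2 * C1 `^ q * \sum_(k < n) (c k * rad k).
  rewrite mulr_sumr; apply: eq_bigr => k _; rewrite -/(rad k.+1) /c.
  rewrite powR_divr ?(ltW C10) ?(ltW (h0 _))// radS.
  have C1q : 0 < C1 `^ q by exact: powR_gt0.
  by field; rewrite !gt_eqF.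
by rewrite -(mulrA (2 * C1 `^ q)) ler_wpM2l ?mulr_ge0 ?powR_ge0.
Qed.

(** Of the power p, the part p - q >= 0 is estimated at r by almost monotonicity, and the part q is
    summed by [dyadic_sum_q]. *)
Lemma dyadic_sum_p r n : 0 < r ->
  \sum_(k < n) h (2 ^+ k.+1 * r) `^ p <=
    C1 `^ (p - q) * (2 * C1 `^ q * C) * h r `^ p.
Proof.
move=> r0.
have split t : 0 < t -> h t `^ p = h t `^ (p - q) * h t `^ q.
  by move=> t0; rewrite -powRD ?(gt_eqF (h0 t0)) ?implybT// subrK.
apply: (@le_trans _ _ (\sum_(k < n) (C1 * h r) `^ (p - q) * h (2 ^+ k.+1 * r) `^ q)).
  apply: ler_sum => k _; have r1 : r <= 2 ^+ k.+1 * r.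
    by rewrite ler_pMl// exprn_ege1// ler1n.
  have rk := lt_le_trans r0 r1.
  rewrite split// ler_wpM2r ?powR_ge0//; apply: le_powR.
  - by rewrite subr_ge0.
  - exact/ltW/h0.
  - exact: dec.
rewrite -mulr_sumr (powRM _ (ltW C10) (ltW (h0 r0))) (split r r0).
set H := h r `^ (p - q); set S := \sum_(k < n) _.
have -> : C1 `^ (p - q) * (2 * C1 `^ q * C) * (H * h r `^ q) =
  C1 `^ (p - q) * H * (2 * C1 `^ q * C * h r `^ q) by ring.
by apply: ler_wpM2l; [rewrite mulr_ge0 ?powR_ge0|exact: dyadic_sum_q].
Qed.

End dyadic_sum.

(** * Potentials of signed functions *)

Section signed_potential.
Context {disp} {T : measurableType disp} {R : realType}.
Variables (dist : T -> T -> R) (mu : {sigma_finite_measure set T -> \bar R}).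
Variables (D c0 c1 : R).
Hypothesis reg : ahlfors_regular dist mu D c0 c1.

(** Tonelli gives measurability of the positive and the negative part separately. Taking [fine] of
    their difference covers the points without convergence as well. *)
Lemma measurable_signed_potential (a : R) (g : T -> R) : measurable_fun setT g ->
  measurable_fun setT (fun x => \int[mu]_y (g y * kernel dist D a x y) : R).
Proof.
move=> mg; pose f (u : T * T) : \bar R := (g u.2 * kernel dist D a u.1 u.2)%:E.
have mf : measurable_fun setT f.
  apply/measurable_EFinP; apply: measurable_funM.
    exact: (measurableT_comp mg measurable_snd).
  exact: (measurable_kernel reg).
apply: (measurableT_comp (fine_measurable measurableT)).
under eq_fun do rewrite integralE.
apply: emeasurable_funB.
- rewrite (_ : (fun x => _) = fubini_F mu (f^\+)%E); last first.
    by apply/funext => x; apply: eq_integral => y _; rewrite !funeposE.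
  apply: measurable_fun_fubini_tonelli_F; first exact: measurable_funepos.
  by move=> u; exact: funepos_ge0.
- rewrite (_ : (fun x => _) = fubini_F mu (f^\-)%E); last first.
    by apply/funext => x; apply: eq_integral => y _; rewrite !funenegE.
  apply: measurable_fun_fubini_tonelli_F; first exact: measurable_funeneg.
  by move=> u; exact: funeneg_ge0.
Qed.

Variables (a : R) (F g : T -> R) (x : T).
Hypotheses (mg : measurable_fun setT g).
Hypotheses (gF : forall y, `|g y| <= F y).

Let g_potential_le :
  (\int[mu]_y `|(g y * kernel dist D a x y)%:E| <= potential dist mu D a F x)%E.
Proof.
apply: le_integral_ge0 => y _ //.
rewrite abse_EFin lee_fin normrM (ger0_norm (kernel_ge0 dist D a x y)).
by rewrite ler_wpM2r// kernel_ge0.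
Qed.

Lemma integrable_signed_potential : (potential dist mu D a F x < +oo)%E ->
  mu.-integrable setT (fun y => (g y * kernel dist D a x y)%:E).
Proof.
move=> Ffin; apply/integrableP; split; last exact: le_lt_trans Ffin.
exact: (measurable_potential_integrand reg).
Qed.

Lemma signed_potential_le :
  ((`|\int[mu]_y (g y * kernel dist D a x y)|)%:E <= potential dist mu D a F x)%E.
Proof.
apply: le_trans g_potential_le.
apply: le_trans (le_abse_integral mu measurableT _); last first.
  exact: (measurable_potential_integrand reg).
(* An infinite integral has [fine] value 0, so the inequality persists where the integral is
   infinite. *)
by rewrite /Rintegral; case: (\int[mu]_y _)%E => [r|/=|/=]//; rewrite normr0 leey.
Qed.

End signed_potential.

Section amalgam_transfer.
Context {disp} {T : measurableType disp} {R : realType}.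
Variables (dist : T -> T -> R) (mu : {sigma_finite_measure set T -> \bar R}).
Variables (D c0 c1 : R).
Hypothesis reg : ahlfors_regular dist mu D c0 c1.

Local Notation potential := (potential dist mu D).
Local Notation amalgam := (amalgam dist mu).

Variables (a b q C' : R) (phi : R -> R).
Hypotheses (a0 : 0 < a) (aD : a < D) (ab0 : a + b < 0) (q1 : 1 < q).
Hypotheses (phi0 : forall r, 0 < r -> 0 < phi r) (C'0 : 0 < C').
Hypothesis phi_le : forall r, 0 < r -> phi r <= C' * r `^ b.

Let th := 1 + a / b.
Let th0 : 0 < th. Proof. exact: exponent_gt0. Qed.
Let q0 : 0 < q. Proof. exact: lt_trans q1. Qed.

Local Notation w := (amalgam_weight D q phi).

(** The normalised bounds are applied to [F / M]. [F'] is meant to be the modulus of the Riesz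
    potential, the 2 counting its real and imaginary parts; the premise [T] supplies the centre of
    the balls that exhaust the space. *)
Lemma amalgam_transfer_Lp (p Cs : R) : 0 < p -> 0 < Cs ->
  (forall r n, 0 < r -> \sum_(k < n) (phi (2 ^+ k.+1 * r) *
      (2 ^+ k.+1 * r) `^ (D / p)) `^ p <= Cs * (phi r * r `^ (D / p)) `^ p) ->
  exists2 K : R, 0 < K & forall (F : T -> R) M, measurable_fun setT F ->
  (forall x, 0 <= F x) -> 0 < M ->
  (forall r, 0 < r -> (amalgam q%:E p%:E r F <= (M * w p^-1 r)%:E)%E) ->
  (T -> {ae mu, forall x, (potential a F x < +oo)%E}) /\
  (forall F' : T -> R, (forall x, 0 <= F' x) ->
    (forall x, ((F' x)%:E <= 2%:E * potential a F x)%E) ->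
    forall r, 0 < r ->
    (amalgam (q / th)%:E (p / th)%:E r F' <= (K * M * w p^-1 r `^ th)%:E)%E).
Proof.
move=> p0 Cs0 Hsum.
have [K K0 HK] := potential_amalgam_Lp reg a0 aD ab0 q1 phi0 C'0 phi_le p0 Cs0 Hsum.
exists (2 * (K `^ p^-1) `^ th); first by rewrite mulr_gt0 ?powR_gt0.
move=> F M mF F0 M0 HF.
have mG : measurable_fun setT (fun x => F x / M) by exact: measurable_funM.
have G0 x : 0 <= F x / M by rewrite divr_ge0// ltW.
have w0 r : 0 < r -> 0 < w p^-1 r by move=> r0; exact: amalgam_weight_gt0.
have [|Vfin HV] := HK _ mG G0.
  by move=> r r0; apply: (amalgam_Lp_scale reg q1 M0 mF F0 p0 (w0 r r0)); exact: HF.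
split; first by move=> y0; apply: (potential_fin_ae reg a0 ab0 q1 M0 mF F0 y0 Vfin).
move=> F' F'0 F'le r r0.
have wr := w0 r r0.
have -> : 2 * (K `^ p^-1) `^ th * M * w p^-1 r `^ th =
    2 * M * (K `^ p^-1 * w p^-1 r) `^ th.
  by rewrite (powRM _ (powR_ge0 _ _) (ltW wr)); ring.
apply: (amalgam_potential_Lp reg a0 ab0 q1 M0 mF F0 (ltr0Sn R 1) F'0 F'le p0).
  by rewrite mulr_ge0 ?powR_ge0// ltW.
apply: le_trans (HV r r0) _; rewrite lee_fin (powRM _ (powR_ge0 _ _) (ltW wr)).
by rewrite -powRrM mulVf ?gt_eqF// powRr1// ltW.
Qed.

Lemma amalgam_transfer_Loo (Cd : R) : 0 < Cd -> (0 < mu setT)%E ->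
  (forall r s, 0 < r -> r <= s -> phi s <= Cd * phi r) ->
  exists2 K : R, 0 < K & forall (F : T -> R) M, measurable_fun setT F ->
  (forall x, 0 <= F x) -> 0 < M ->
  (forall r, 0 < r -> (amalgam q%:E +oo%E r F <= (M * w 0 r)%:E)%E) ->
  (T -> {ae mu, forall x, (potential a F x < +oo)%E}) /\
  (forall F' : T -> R, (forall x, 0 <= F' x) ->
    (forall x, ((F' x)%:E <= 2%:E * potential a F x)%E) ->
    forall r, 0 < r ->
    (amalgam (q / th)%:E +oo%E r F' <= (K * M * w 0 r `^ th)%:E)%E).
Proof.
move=> Cd0 muT dec.
have [K K0 HK] := potential_amalgam_Loo reg a0 aD ab0 q1 phi0 C'0 phi_le Cd0 dec.
exists (2 * (K `^ q^-1) `^ th); first by rewrite mulr_gt0 ?powR_gt0.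
move=> F M mF F0 M0 HF.
have mG : measurable_fun setT (fun x => F x / M) by exact: measurable_funM.
have G0 x : 0 <= F x / M by rewrite divr_ge0// ltW.
have w0 r : 0 < r -> 0 < w 0 r by move=> r0; exact: amalgam_weight_gt0.
have [|Vfin HV] := HK _ mG G0.
  by move=> r r0; apply: (amalgam_Loo_scale reg q1 M0 mF F0 (w0 r r0) muT); exact: HF.
split; first by move=> y0; apply: (potential_fin_ae reg a0 ab0 q1 M0 mF F0 y0 Vfin).
move=> F' F'0 F'le r r0.
have wr := w0 r r0.
have -> : 2 * (K `^ q^-1) `^ th * M * w 0 r `^ th =
    2 * M * (K `^ q^-1 * w 0 r) `^ th.
  by rewrite (powRM _ (powR_ge0 _ _) (ltW wr)); ring.
apply: (amalgam_potential_Loo reg a0 ab0 q1 M0 mF F0 (ltr0Sn R 1) F'0 F'le) => //.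
  by rewrite mulr_ge0 ?powR_ge0// ltW.
apply: filterS (HV r r0) => y /le_trans; apply.
rewrite lee_fin (powRM _ (powR_ge0 _ _) (ltW wr)).
by rewrite -powRrM mulVf ?gt_eqF// powRr1// ltW.
Qed.

End amalgam_transfer.

(** * The Riesz potential on R^d *)

Section euclidean_riesz.
Context {R : realType} {d : nat}.
Implicit Types (f : Rd R d -> R[i]).

Local Notation edist := (@Defs.edist R d).
Local Notation mu := (@leb R d).

Lemma leb_regular : (0 < d)%N ->
  ahlfors_regular edist mu d%:R ((2 / d.+1%:R) ^+ d) (2 ^+ d).
Proof.
move=> d0; split.
- by rewrite ltr0n.
- by rewrite exprn_gt0// divr_gt0.
- by rewrite exprn_gt0.
- exact: edist_ge0.
- exact: edistC.
- exact: edist_triangle.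
- exact: measurable_edist.
- by move=> x r r0; exact: leb_eball_ge.
- by move=> x r r0; exact: leb_eball_le.
Qed.

Lemma leb_setT_gt0 : (0 < mu setT)%E.
Proof.
have y : Rd R d by exact: point.
apply: lt_le_trans (_ : (mu (eball y 1) <= _)%E).
  apply: lt_le_trans (leb_eball_ge y ltr01).
  by rewrite lte_fin mulr_gt0 ?powR_gt0// exprn_gt0// divr_gt0.
by apply: le_measure => //; rewrite inE//; exact: measurable_eball.
Qed.

Lemma normcE (z : R[i]) :
  Normc.normc z = (complex.Re z ^+ 2 + complex.Im z ^+ 2) `^ 2^-1.
Proof. by case: z => x y /=; rewrite powR12_sqrt// addr_ge0 ?sqr_ge0. Qed.

Lemma normc_ge_Re (z : R[i]) : `|complex.Re z| <= Normc.normc z.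
Proof. by case: z => x y /=; rewrite -sqrtr_sqr ler_wsqrtr// lerDl sqr_ge0. Qed.

Lemma normc_ge_Im (z : R[i]) : `|complex.Im z| <= Normc.normc z.
Proof. by case: z => x y /=; rewrite -sqrtr_sqr ler_wsqrtr// lerDr sqr_ge0. Qed.

Lemma normc_ge0 (z : R[i]) : 0 <= Normc.normc z.
Proof. exact: le_trans (normc_ge_Re z). Qed.

Lemma normc_le (z : R[i]) :
  Normc.normc z <= `|complex.Re z| + `|complex.Im z|.
Proof.
case: z => x y /=.
rewrite -(@ler_pXn2r _ 2)// ?nnegrE ?sqrtr_ge0 ?addr_ge0//.
rewrite sqr_sqrtr ?addr_ge0 ?sqr_ge0// sqrrD !real_normK ?num_real//.
have : 0 <= `|x| * `|y| by rewrite mulr_ge0.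
rewrite -mulr_natl; lra.
Qed.

Lemma measurable_normc f : in_L0 f ->
  measurable_fun setT (fun x => Normc.normc (f x)).
Proof.
move=> [mRe mIm]; under eq_fun do rewrite normcE.
apply: (measurableT_comp (measurable_powR _)).
by apply: measurable_funD; exact: measurable_funX.
Qed.

Section riesz.
Variables (gamma : R) (f : Rd R d -> R[i]).
Hypotheses (d0 : (0 < d)%N) (Lf : in_L0 f).

Let F x := Normc.normc (f x).
Let reg := leb_regular d0.

Lemma riesz_cvg_fin x : (potential edist mu d%:R gamma F x < +oo)%E ->
  riesz_cvg gamma f x.
Proof.
have [mRe mIm] := Lf.
move=> Fx; split; apply: (integrable_signed_potential reg _ _ Fx) => // y.
- exact: normc_ge_Re.
- exact: normc_ge_Im.
Qed.

Lemma in_L0_riesz : in_L0 (riesz gamma f).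
Proof.
have [mRe mIm] := Lf.
by split; exact: (measurable_signed_potential reg).
Qed.

Lemma riesz_le_potential x :
  ((Normc.normc (riesz gamma f x))%:E <= 2%:E * potential edist mu d%:R gamma F x)%E.
Proof.
have [mRe mIm] := Lf.
apply: (@le_trans _ _ (`|complex.Re (riesz gamma f x)|%:E +
    `|complex.Im (riesz gamma f x)|%:E)%E).
  by rewrite -EFinD lee_fin; exact: normc_le.
have -> : (2%:E * potential edist mu d%:R gamma F x =
    potential edist mu d%:R gamma F x + potential edist mu d%:R gamma F x)%E.
  by rewrite -[2]/(1 + 1) EFinD ge0_muleDl ?lee_fin// mul1e.
by apply: leeD; apply: (signed_potential_le reg) => // y;
  [exact: normc_ge_Re|exact: normc_ge_Im].
Qed.

End riesz.
End euclidean_riesz.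

(** The prefactor of the Fofana norm is an inverse power of the weight: s = 1 gives the source norm,
    and s = [th] the target norm, where [psi] and both reciprocal exponents carry the same [th]. *)
Lemma inv_amalgam_weight (R : realType) (D q ip r s : R) (phi : R -> R) :
  0 < phi r -> 0 < r ->
  (phi r `^ s)^-1 * r `^ (D * (- (s * q^-1) - s * ip)) =
    (amalgam_weight D q phi ip r `^ s)^-1.
Proof.
move=> phi0 r0; rewrite /amalgam_weight (powRM _ (ltW phi0) (powR_ge0 _ _)) invfM.
rewrite -powRrM -(powRN r); congr (_ * _ `^ _); ring.
Qed.

Section norm_estimate.
Context {R : realType} {d : nat}.
Variables (q th beta gamma ip K : R) (p pbar : \bar R) (phi psi : R -> R).
Hypotheses (d0 : (0 < d)%N) (q0 : 0 < q) (th0 : 0 < th) (K0 : 0 < K).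
Hypothesis phi0 : forall r, 0 < r -> 0 < phi r.
Hypothesis psiE : forall r, 0 < r -> psi r = phi r `^ th.
Hypotheses (rinvp : rinv p = ip) (rinvpbar : rinv pbar = th * ip).

Local Notation w := (amalgam_weight d%:R q phi ip).
Local Notation amalgam := (amalgam (@Defs.edist R d) (@leb R d)).
Local Notation potential := (potential (@Defs.edist R d) (@leb R d) d%:R gamma).

Hypothesis transfer : forall (F : Rd R d -> R) M, measurable_fun setT F ->
  (forall x, 0 <= F x) -> 0 < M ->
  (forall r, 0 < r -> (amalgam q%:E p r F <= (M * w r)%:E)%E) ->
  (Rd R d -> {ae @leb R d, forall x, (potential F x < +oo)%E}) /\
  (forall F' : Rd R d -> R, (forall x, 0 <= F' x) ->
    (forall x, ((F' x)%:E <= 2%:E * potential F x)%E) ->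
    forall r, 0 < r ->
    (amalgam (q / th)%:E pbar r F' <= (K * M * w r `^ th)%:E)%E).

Let rinvq : rinv q%:E = q^-1.
Proof. by rewrite /rinv inver gt_eqF. Qed.

Let rinvqbar : rinv (q / th)%:E = th * q^-1.
Proof. by rewrite /rinv inver gt_eqF ?divr_gt0//= invf_div. Qed.

(** [transfer] is the form shared by finite and infinite p. It is linear in [M], so the norm itself
    can be taken for [M] when it is positive. *)
Lemma riesz_norm_estimate f : fofana q%:E p phi f ->
  [/\ {ae @leb R d, forall x, riesz_cvg gamma f x},
      in_L0 (riesz gamma f)
    & (fofana_norm (q / th)%:E pbar psi (riesz gamma f)
        <= K%:E * fofana_norm q%:E p phi f)%E].
Proof.
move=> [Lf Nfin]; have mF := measurable_normc Lf.
have F0 x := normc_ge0 (f x).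
have w0 r : 0 < r -> 0 < w r by move=> r0; exact: amalgam_weight_gt0.
have below M : 0 < M -> (fofana_norm q%:E p phi f <= M%:E)%E -> forall r, 0 < r ->
    (amalgam q%:E p r (fun x => Normc.normc (f x)) <= (M * w r)%:E)%E.
  move=> M0 NM r r0.
  have : (((phi r)^-1 * r `^ (d%:R * (- rinv q%:E - rinv p)))%:E *
      amalgam q%:E p r (fun x => Normc.normc (f x)) <= M%:E)%E.
    apply: le_trans NM; apply: ereal_sup_ubound; exists r => //.
    by rewrite /= in_itv/= r0.
  have := inv_amalgam_weight d%:R q ip 1 (phi0 r0) r0.
  rewrite !mul1r (powRr1 (ltW (phi0 r0))) (powRr1 (ltW (w0 r r0))) rinvq rinvp => ->.
  by rewrite lee_pdivrMl ?w0// -EFinM mulrC.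
have above M : 0 < M -> (fofana_norm q%:E p phi f <= M%:E)%E ->
    (fofana_norm (q / th)%:E pbar psi (riesz gamma f) <= (K * M)%:E)%E.
  move=> M0 NM; have [_ H] := transfer mF F0 M0 (below M M0 NM).
  apply: ge_ereal_sup => _ [r /= rin <-].
  have r0 : 0 < r by move: rin; rewrite in_itv/= andbT.
  have {}H := H (fun x => Normc.normc (riesz gamma f x))
    (fun x => normc_ge0 _) (riesz_le_potential gamma d0 Lf) r r0.
  rewrite psiE// rinvqbar rinvpbar inv_amalgam_weight ?phi0//.
  rewrite lee_pdivrMl; last by rewrite powR_gt0// w0.
  by rewrite -EFinM [w r `^ th * _]mulrC; exact: H.
have N0 : (0 <= fofana_norm q%:E p phi f)%E.
  apply: (@le_trans _ _ (((phi 1)^-1 * 1 `^ (d%:R * (- rinv q%:E - rinv p)))%:E *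
      amalgam_norm 1 q%:E p f)%E).
    by rewrite mule_ge0 ?Lnorm_ge0// lee_fin mulr_ge0 ?powR_ge0// invr_ge0 ltW// phi0.
  by apply: ereal_sup_ubound; exists 1 => //; rewrite /= in_itv/= ltr01.
split; last 1 first.
- move: N0 Nfin above; case: (fofana_norm q%:E p phi f) => [N| |]//.
  rewrite lee_fin le_eqVlt => /predU1P[<- _ above|N0 _ above]; last first.
    by rewrite -EFinM; exact: above.
  (* [M] must be positive, so a zero norm is treated with [M = e / K] and e tending to 0. *)
  rewrite mule0; apply/lee_addgt0Pr => e e0; rewrite add0e.
  have -> : e = K * (e / K) by rewrite mulrC divfK// gt_eqF.
  by apply: above; rewrite ?lee_fin ?ltW// divr_gt0.
(* For convergence any positive bound of the norm will do; [N + 1] is positive even when [N] is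
   0. *)
- have : exists2 M : R, 0 < M & (fofana_norm q%:E p phi f <= M%:E)%E.
    move: N0 Nfin; case: (fofana_norm q%:E p phi f) => [N| |]//.
    rewrite lee_fin => N0 _; exists (N + 1); first by rewrite ltr_wpDl.
    by rewrite lee_fin lerDl.
  move=> [M M0 NM]; have [/(_ point) Pfin _] := transfer mF F0 M0 (below M M0 NM).
  by apply: filterS Pfin => x; exact: riesz_cvg_fin.
- exact: in_L0_riesz.
Qed.

End norm_estimate.

Theorem theorem3p1 (R : realType) (d : nat) (q p qbar pbar : \bar R)
    (gamma beta : R) (phi psi : R -> R)
    (q_gt1 : (1%:E < q)%E) (q_le_p : (q <= p)%E)
    (gamma_gt0 : 0 < gamma) (gamma_lt : gamma < d%:R * rinv q)
    (beta_ge : - (d%:R * rinv q) <= beta) (beta_lt : beta < - gamma)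
    (phiG : class_G (d := d) q p phi)
    (phi_int : exists2 C : R, 0 < C & forall r, 0 < r ->
       (\int[@lebesgue_measure R]_(t in `]r, +oo[)
           (phi t `^ fine q * t `^ (d%:R * fine q * rinv p - 1))%:E
        <= (C * (phi r `^ fine q * r `^ (d%:R * fine q * rinv p)))%:E)%E)
    (phi_le : exists2 C' : R, 0 < C' & forall r, 0 < r -> phi r <= C' * r `^ beta)
    (pbarE : (pbar^-1 = p^-1 * (1 + gamma / beta)%:E)%E)
    (qbarE : (qbar^-1 = q^-1 * (1 + gamma / beta)%:E)%E)
    (psiE : forall r, 0 < r -> psi r = phi r `^ (fine q * rinv qbar)) :
  exists2 K : R, 0 < K &
    forall f : Rd R d -> R[i], fofana q p phi f ->
      [/\ {ae @leb R d, forall x, riesz_cvg gamma f x},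
          in_L0 (riesz gamma f)
        & (fofana_norm qbar pbar psi (riesz gamma f)
           <= K%:E * fofana_norm q p phi f)%E].
Proof.
(* An infinite [q] has [rinv q = 0], which would force [gamma < 0]; dimension 0 is excluded below in
   the same way. *)
case: q q_gt1 q_le_p gamma_lt beta_ge phiG phi_int qbarE psiE => [qr| |]//; last first.
  by move=> _ _; rewrite /rinv invey mulr0 ltNge (ltW gamma_gt0).
rewrite lte_fin => q1 q_le_p' gamma_lt' _ [phi0 decp _] phi_int' qbarE' psiE'.
have q0 : 0 < qr by exact: lt_trans q1.
have rinvq : rinv qr%:E = qr^-1 by rewrite /rinv inver gt_eqF.
rewrite rinvq in gamma_lt'.
have d0 : (0 < d)%N.
  rewrite lt0n; apply/eqP => d0; move: gamma_lt'.
  by rewrite d0 mul0r ltNge (ltW gamma_gt0).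
have D0 : 0 < d%:R :> R by rewrite ltr0n.
have aD : gamma < d%:R.
  by apply: (lt_le_trans gamma_lt'); rewrite ler_piMr ?(ltW D0)// invf_le1// ltW.
have ab0 : gamma + beta < 0 by move: beta_lt; lra.
pose th := 1 + gamma / beta.
have th0 : 0 < th by exact: exponent_gt0.
have qbarE2 : qbar = (qr / th)%:E.
  rewrite -[qbar]inveK qbarE' inver gt_eqF// -EFinM inver.
  by rewrite gt_eqF ?mulr_gt0 ?invr_gt0// invfM invrK.
have psi_th r : 0 < r -> psi r = phi r `^ th.
  move=> r0; rewrite psiE'// qbarE2 /rinv inver gt_eqF ?divr_gt0//= invf_div.
  by rewrite mulrC divfK// gt_eqF.
have [C' C'0 phi_le'] := phi_le.
have reg := @leb_regular R d d0.
have [Cd Cd0 dec] := decp.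
rewrite qbarE2.
case: p q_le_p' decp dec phi_int' pbarE => [pr| |]//.
- rewrite lee_fin => qp _ dec [C C0 phi_int'] pbarE'.
  have p0 : 0 < pr by exact: lt_le_trans qp.
  have rinvp : rinv pr%:E = pr^-1 by rewrite /rinv inver gt_eqF.
  rewrite rinvp in dec phi_int'.
  have pbarE2 : pbar = (pr / th)%:E.
    rewrite -[pbar]inveK pbarE' inver gt_eqF// -EFinM inver.
    by rewrite gt_eqF ?mulr_gt0 ?invr_gt0// invfM invrK.
  have phi_int2 r : 0 < r ->
      (\int[@lebesgue_measure R]_(t in `]r, +oo[)
        (phi t `^ qr * t `^ (d%:R / pr * qr - 1))%:E
      <= (C * (phi r `^ qr * r `^ (d%:R / pr * qr)))%:E)%E.
    by have := phi_int' r; rewrite /= (mulrAC _ qr).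
  have Hsum r n := @dyadic_sum_p R phi _ qr pr C Cd q0 qp Cd0 phi0 dec phi_int2 r n.
  have Cs0 : 0 < Cd `^ (pr - qr) * (2 * Cd `^ qr * C).
    by rewrite !mulr_gt0 ?powR_gt0.
  have [K K0 HK] := amalgam_transfer_Lp reg gamma_gt0 aD ab0 q1 phi0 C'0 phi_le'
    p0 Cs0 Hsum.
  exists K; first exact: K0.
  move=> f; rewrite pbarE2.
  apply: (riesz_norm_estimate d0 q0 th0 K0 phi0 psi_th rinvp); last exact: HK.
  by rewrite /rinv inver gt_eqF ?divr_gt0//= invf_div.
- move=> _ _ dec _ pbarE'.
  have rinvp : rinv +oo = 0 :> R by rewrite /rinv invey.
  have pbarE2 : pbar = +oo%E.
    by apply/eqP; rewrite -inve_eq0 pbarE' invey mul0e.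
  (* For infinite p the power of t in the first monotonicity condition of [class_G] has exponent 0,
     so [phi] itself is almost decreasing. *)
  have dec' r s : 0 < r -> r <= s -> phi s <= Cd * phi r.
    by move=> r0 rs; have := dec r s r0 rs; rewrite rinvp mulr0 !powRr0 !mulr1.
  have [K K0 HK] := amalgam_transfer_Loo reg gamma_gt0 aD ab0 q1 phi0 C'0 phi_le' Cd0
    (@leb_setT_gt0 R d) dec'.
  exists K; first exact: K0.
  move=> f; rewrite pbarE2.
  apply: (riesz_norm_estimate d0 q0 th0 K0 phi0 psi_th rinvp); last exact: HK.
  by rewrite rinvp mulr0.
Qed.
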